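(* Let $z_0,w_0\in\mathbb{D}$ with $|w_0|=s<r=|z_0|$, let $\lambda,\mu\in\overline{\mathbb{D}}$, and put $$w_1=\frac{w_0}{z_0}+\frac{r^2-s^2}{z_0(1-r^2)}\lambda,\qquad w_2=\frac{2(r^2-s^2)\lambda(1-\overline{w_0}\lambda)}{z_0^2(1-r^2)^2}+\frac{2(r^2-s^2)(1-|\lambda|^2)}{z_0(1-r^2)^2}\mu .$$ Define $$\mathcal{B}=\overline{w_0}^2\lambda^3-\overline{w_0}(1+r^2)\lambda^2+r^2\lambda,$$ $$c=\frac{6(r^2-s^2)}{z_0^3(1-r^2)^3}\Big(\mathcal{B}+z_0\mu(1-|\lambda|^2)(1+r^2-2\overline{w_0}\lambda-z_0\overline{\lambda}\mu)\Big),\qquad \rho=\frac{6(r^2-s^2)}{r(1-r^2)^3}(1-|\lambda|^2)(1-|\mu|^2).$$ Suppose that $f\in\mathcal{H}_0$, $f(z_0)=w_0$, $f'(z_0)=w_1$ and $f''(z_0)=w_2$. Set $u_0=w_0/z_0$, $v_0=r^2\lambda/z_0^2$. (1) If $|\lambda|=1$, then $f'''(z_0)=c$ and $f(z)=z\,T_{u_0}\big(v_0T_{-z_0}(z)\big)$. (2) If $|\lambda|<1$ and $|\mu|=1$, then $f'''(z_0)=c$ and $f(z)=z\,T_{u_0}\big(T_{-z_0}(z)\,T_{v_0}(\tau T_{-z_0}(z))\big)$, where $\tau=\overline{z_0}\mu/z_0$. (3) If $|\lambda|<1$ and $|\mu|<1$, then the region of values of $f'''(z_0)$ is the closed disk $\overline{\mathbb{D}}(c,\rho)$.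 Furthermore, $f'''(z_0)\in\partial\mathbb{D}(c,\rho)$ if and only if $$f(z)=z\,T_{u_0}\Big(T_{-z_0}(z)\,T_{v_0}\big(T_{-z_0}(z)\,T_{\eta}(e^{i\theta}T_{-z_0}(z))\big)\Big),$$ where $\theta\in\mathbb{R}$ and $$\eta=\frac{r^2\mu}{z_0^2}+\frac{\lambda^2r^2(r^2w_0-z_0^2\overline{w_0})}{z_0^5(1-|\lambda|^2)}.$$
   Context: $\mathbb{D}=\{z\in\mathbb{C}:|z|<1\}$ is the open unit disk and $\overline{\mathbb{D}}$ is its closure. $\mathcal{H}_0$ is the set of all analytic self-maps $f$ of $\mathbb{D}$ with $f(0)=0$. For $c\in\mathbb{C}$ and $\rho>0$, $\mathbb{D}(c,\rho)=\{\zeta\in\mathbb{C}:|\zeta-c|<\rho\}$ and $\overline{\mathbb{D}}(c,\rho)=\{\zeta\in\mathbb{C}:|\zeta-c|\le\rho\}$. $T_a$ denotes the Möbius transformation $T_a(z)=\dfrac{z+a}{1+\overline{a}z}$, $z,a\in\mathbb{D}$. In (3), the region of values of $f'''(z_0)$ is the set $\{f'''(z_0): f\in\mathcal{H}_0,\ f(z_0)=w_0,\ f'(z_0)=w_1,\ f''(z_0)=w_2\}$.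
   Formalization: In (3), η is taken as r²μ/z₀²; the printed second summand is dropped, since f''(z₀)=w₂ forces this value and the printed ''if and only if'' fails, e.g. for z₀=1/2, w₀=i/4, λ=1/2, μ=0, where that summand equals i/3. *)

(* Defs.v *)
From Stdlib Require Export Reals.
From Coquelicot Require Export Coquelicot.

Set Implicit Arguments.
Unset Strict Implicit.
Unset Printing Implicit Defensive.

Local Open Scope C_scope.

Definition open_disk (c : C) (rho : R) (z : C) : Prop := (Cmod (z - c) < rho)%R.
Definition closed_disk (c : C) (rho : R) (z : C) : Prop := (Cmod (z - c) <= rho)%R.
Definition unit_disk : C -> Prop := open_disk 0 1.
Definition closed_unit_disk : C -> Prop := closed_disk 0 1.

(* A point is on the boundary iff it is interior neither to [A] nor to the
   complement of [A]. *)
Definition boundary (A : C -> Prop) (z : C) : Prop :=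
  ~ locally z A /\ ~ locally z (fun w => ~ A w).

Definition analytic_on (U : C -> Prop) (f : C -> C) : Prop :=
  forall z : C, U z ->
    exists (a : nat -> C) (delta : R),
      (0 < delta)%R /\
      forall h : C, (Cmod h < delta)%R -> is_pseries a h (f (z + h)).

(* Self-maps of the disk are represented by total functions on [C]; values
   outside the disk are irrelevant. *)
Definition H0 (f : C -> C) : Prop :=
  analytic_on unit_disk f /\
  (forall z : C, unit_disk z -> unit_disk (f z)) /\
  f 0 = 0.

(* [C_derive] is total.  For a function in [H0] all the iterated complex
   derivatives exist in the disk, so there [C_derive_n] gives the usual values. *)
Definition C_derive_n (f : C -> C) (n : nat) : C -> C := Nat.iter n C_derive f.

Definition T (a z : C) : C := (z + a) / (1 + Cconj a * z).

Definition expi (theta : R) : C := (cos theta, sin theta).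

Definition has_data (z0 w0 w1 w2 : C) (f : C -> C) : Prop :=
  H0 f /\ f z0 = w0 /\ C_derive_n f 1 z0 = w1 /\ C_derive_n f 2 z0 = w2.

Definition region_of_values (z0 w0 w1 w2 : C) (w3 : C) : Prop :=
  exists f : C -> C, has_data z0 w0 w1 w2 f /\ C_derive_n f 3 z0 = w3.

(* Main.v *)
Require Import Defs.
From Stdlib Require Import Lra Lia Classical ClassicalEpsilon List.

Set Implicit Arguments.
Unset Strict Implicit.
Unset Printing Implicit Defensive.

Local Open Scope C_scope.

(** The argument is the Schur algorithm. Write [t x = T (- z0) x]. By the Schwarz lemma
    [f x = x * g x] with [g] mapping the disk into the closed disk, and [g z0 = w0 / z0].
    If a self-map [g] of this kind has [|g z0| < 1], then [T (- g z0) (g x)] vanishes at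
    [z0], so that [g x = T (g z0) (t x * y x)] with [y] again such a self-map; if
    [|g z0| = 1], then [g] is constant ([schur_step], [schur_unimodular_const]). Repeating
    the step writes [f] as a nest of Moebius maps around a last function [k].

    Comparing Taylor coefficients at [z0], the numbers [w0], [w1], [w2] prescribe one by
    one the values at [z0] of the functions met on the way: they are [w0 / z0] and the
    rotations of [lambda] and of [mu] by [Cconj z0 / z0]. A parameter of modulus one stops
    the algorithm and determines [f]: these are the cases [|lambda| = 1] and [|mu| = 1].
    Otherwise [k] is an
    arbitrary self-map, and [f''' (z0)] is an affine function of [k z0] with slope of
    modulus [rho] ([derivatives_of_parameters]). Since [k z0] fills the closed unit disk,
    [f''' (z0)] fills the closed disk of radius [rho]; and it lies on the circle exactly
    when [|k z0| = 1], that is when [k] is a unimodular constant.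

    The analysis is kept elementary. The functions met by the algorithm are only known
    through their finite Taylor expansions, of every order and at every point of the disk.
    This is stable under the algebraic operations and under division by a simple zero, and
    it suffices for the maximum principle ([maximum_principle]). Power series enter through
    [f] itself, to expand it and to read its derivatives off the Taylor coefficients
    ([derivatives_of_expansion]), and once more to see that the functions which realize the values in
    the disk, being rational, are analytic ([rational_analytic]). *)

(** * Finite Taylor expansions *)

Definition near0 (P : C -> Prop) : Prop :=
  exists delta : R, (0 < delta)%R /\ forall h : C, (Cmod h < delta)%R -> P h.

Lemma near0_and (P Q : C -> Prop) :
  near0 P -> near0 Q -> near0 (fun h => P h /\ Q h).
Proof.
  intros [d1 [H1 P1]] [d2 [H2 P2]].
  exists (Rmin d1 d2). split.
  - now apply Rmin_glb_lt.
  - intros h Hh. split.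
    + apply P1. eapply Rlt_le_trans; [exact Hh | apply Rmin_l].
    + apply P2. eapply Rlt_le_trans; [exact Hh | apply Rmin_r].
Qed.

Lemma near0_mono (P Q : C -> Prop) :
  (forall h, P h -> Q h) -> near0 P -> near0 Q.
Proof.
  intros HPQ [d [Hd HP]]. exists d. split; auto.
Qed.

Lemma near0_lt (d : R) : (0 < d)%R -> near0 (fun h => (Cmod h < d)%R).
Proof. intros Hd. exists d. auto. Qed.

Lemma near0_at (P : C -> Prop) : near0 P -> P 0.
Proof. intros [d [Hd HP]]. apply HP. rewrite Cmod_0. exact Hd. Qed.

Definition bounded0 (f : C -> C) : Prop :=
  exists M : R, (0 < M)%R /\ near0 (fun h => (Cmod (f h) <= M)%R).

Lemma bounded0_add (f g : C -> C) :
  bounded0 f -> bounded0 g -> bounded0 (fun h => f h + g h).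
Proof.
  intros [M [HM Hf]] [N [HN Hg]]. exists (M + N)%R. split; [lra|].
  apply near0_mono with (2 := near0_and Hf Hg).
  intros h [H1 H2]. eapply Rle_trans; [apply Cmod_triangle|]. lra.
Qed.

Lemma bounded0_mul (f g : C -> C) :
  bounded0 f -> bounded0 g -> bounded0 (fun h => f h * g h).
Proof.
  intros [M [HM Hf]] [N [HN Hg]]. exists (M * N)%R.
  split; [now apply Rmult_lt_0_compat|].
  apply near0_mono with (2 := near0_and Hf Hg).
  intros h [H1 H2]. rewrite Cmod_mult.
  apply Rmult_le_compat; auto using Cmod_ge_0.
Qed.

Lemma bounded0_const (c : C) : bounded0 (fun _ => c).
Proof.
  exists (Cmod c + 1)%R. pose proof (Cmod_ge_0 c). split; [lra|].
  exists 1%R. split; [lra|]. intros; lra.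
Qed.

Lemma bounded0_id : bounded0 (fun h => h).
Proof. exists 1%R. split; [lra|]. exists 1%R. split; [lra|]. intros; lra. Qed.

Lemma bounded0_ext (f g : C -> C) :
  near0 (fun h => f h = g h) -> bounded0 f -> bounded0 g.
Proof.
  intros Hfg [M [HM Hf]]. exists M. split; [exact HM|].
  apply near0_mono with (2 := near0_and Hfg Hf).
  intros h [E H]. now rewrite <- E.
Qed.

(** Finite expansions are defined through iterated difference quotients instead of
    polynomials with a remainder: products, inverses and division by a zero then go by a
    one-line induction. The equation also holds at the base point itself, so that the
    quotient of positive order has the right value there. *)
Fixpoint jet (n : nat) (f : C -> C) : Prop :=
  match n with
  | O => bounded0 f
  | S m => exists (a : C) (g : C -> C),
      jet m g /\ near0 (fun h => f h = a + h * g h)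
  end.

Lemma jet_ext (n : nat) (f g : C -> C) :
  near0 (fun h => f h = g h) -> jet n f -> jet n g.
Proof.
  intros Hfg. destruct n as [|n]; simpl.
  - now apply bounded0_ext.
  - intros [a [f1 [J E]]]. exists a, f1. split; [exact J|].
    apply near0_mono with (2 := near0_and Hfg E). intros h [H1 H2]. congruence.
Qed.

Lemma jet_bounded (n : nat) (f : C -> C) : jet n f -> bounded0 f.
Proof.
  revert f. induction n as [|n IH]; intros f; simpl; [easy|].
  intros [a [g [J E]]].
  apply bounded0_ext with (fun h => a + h * g h).
  - apply near0_mono with (2 := E). intros h H. now symmetry.
  - apply bounded0_add; [apply bounded0_const|].
    apply bounded0_mul; [apply bounded0_id | now apply IH].
Qed.

Lemma jet_S (n : nat) (f : C -> C) : jet (S n) f -> jet n f.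
Proof.
  revert f. induction n as [|n IH]; intros f J.
  - now apply (@jet_bounded 1).
  - destruct J as [a [g [J E]]]. exists a, g. split; [now apply IH | exact E].
Qed.

Lemma jet_const (n : nat) (c : C) : jet n (fun _ => c).
Proof.
  revert c. induction n as [|n IH]; intros c; simpl; [apply bounded0_const|].
  exists c, (fun _ => 0). split; [apply IH|].
  exists 1%R. split; [lra|]. intros; ring.
Qed.

Lemma jet_id (n : nat) : jet n (fun h => h).
Proof.
  destruct n as [|n]; simpl; [apply bounded0_id|].
  exists 0, (fun _ => 1). split; [apply jet_const|].
  exists 1%R. split; [lra|]. intros; ring.
Qed.

Lemma jet_add (n : nat) (f g : C -> C) :
  jet n f -> jet n g -> jet n (fun h => f h + g h).
Proof.
  revert f g. induction n as [|n IH]; intros f g; simpl.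
  - apply bounded0_add.
  - intros [a [f1 [Jf Ef]]] [b [g1 [Jg Eg]]].
    exists (a + b), (fun h => f1 h + g1 h). split; [now apply IH|].
    apply near0_mono with (2 := near0_and Ef Eg).
    intros h [H1 H2]. rewrite H1, H2. ring.
Qed.

Lemma jet_mul (n : nat) (f g : C -> C) :
  jet n f -> jet n g -> jet n (fun h => f h * g h).
Proof.
  revert f g. induction n as [|n IH]; intros f g.
  - apply bounded0_mul.
  - intros [a [f1 [Jf Ef]]] Jg. pose proof (jet_S Jg) as Jg'.
    destruct Jg as [b [g1 [Jg1 Eg]]].
    exists (a * b), (fun h => a * g1 h + f1 h * g h). split.
    + apply jet_add; apply IH; auto using jet_const.
    + apply near0_mono with (2 := near0_and Ef Eg).
      intros h [H1 H2]. rewrite H1, H2. ring.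
Qed.

Lemma jet1_close (f : C -> C) (eps : R) :
  jet 1 f -> (0 < eps)%R -> near0 (fun h => (Cmod (f h - f 0) < eps)%R).
Proof.
  intros [a [g [[M [HM Hg]] E]]] He.
  pose proof (near0_at E) as E0.
  apply near0_mono with (2 := near0_and (near0_and Hg E)
    (@near0_lt (eps / M) (Rdiv_lt_0_compat _ _ He HM))).
  intros h [[H1 H2] H3]. rewrite H2, E0.
  replace (a + h * g h - (a + 0 * g 0)) with (h * g h) by ring.
  rewrite Cmod_mult.
  apply Rle_lt_trans with (Cmod h * M)%R.
  - apply Rmult_le_compat_l; [apply Cmod_ge_0 | exact H1].
  - apply Rlt_le_trans with (eps / M * M)%R.
    + apply Rmult_lt_compat_r; lra.
    + right. field. lra.
Qed.

Lemma jet1_away (f : C -> C) :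
  jet 1 f -> f 0 <> 0 -> near0 (fun h => (Cmod (f 0) / 2 < Cmod (f h))%R).
Proof.
  intros J H0. apply Cmod_gt_0 in H0.
  apply near0_mono with (2 := @jet1_close f (Cmod (f 0) / 2) J ltac:(lra)).
  intros h H.
  pose proof (Cmod_triangle (f h) (- (f h - f 0))) as H1.
  rewrite Cmod_opp in H1.
  replace (f h + - (f h - f 0)) with (f 0) in H1 by ring. lra.
Qed.

(** The difference quotient of [/ f] is [- g / (a * f)], where [g] is that of [f] and
    [a = f 0]. The hypothesis [jet 1 f] is what keeps [f] away from zero when [n = 0]. *)
Lemma jet_inv (n : nat) (f : C -> C) :
  jet 1 f -> f 0 <> 0 -> jet n f -> jet n (fun h => / f h).
Proof.
  intros J1 H0. pose proof (jet1_away J1 H0) as Haway.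
  pose proof (proj1 (Cmod_gt_0 _) H0) as Hpos.
  assert (Hnz : near0 (fun h => f h <> 0)).
  { apply near0_mono with (2 := Haway). intros h Hh Hc.
    rewrite Hc, Cmod_0 in Hh. lra. }
  induction n as [|n IH]; intros J.
  - exists (/ (Cmod (f 0) / 2))%R. split; [apply Rinv_0_lt_compat; lra|].
    apply near0_mono with (2 := near0_and Haway Hnz). intros h [Hh Hz].
    rewrite Cmod_inv by exact Hz. apply Rinv_le_contravar; lra.
  - pose proof (IH (jet_S J)) as JI.
    destruct J as [a [g [Jg E]]].
    assert (Ha : a <> 0).
    { pose proof (near0_at E) as E0. intros Hc. apply H0.
      rewrite E0, Hc. ring. }
    exists (/ a), (fun h => (- / a) * (g h * / f h)). split.
    + apply jet_mul; [apply jet_const|]. now apply jet_mul.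
    + apply near0_mono with (2 := near0_and Hnz E). intros h [Hz Eh].
      rewrite Eh in *. field. now split.
Qed.

(** Finite expansions of every order at [p]; nothing is said about their dependence
    on [p]. *)
Definition smooth (f : C -> C) (p : C) : Prop :=
  forall n : nat, jet n (fun h => f (p + h)).

Lemma smooth_const (c p : C) : smooth (fun _ => c) p.
Proof. intros n. apply jet_const. Qed.

Lemma smooth_id (p : C) : smooth (fun z => z) p.
Proof. intros n. apply jet_add; [apply jet_const | apply jet_id]. Qed.

Lemma smooth_add (f g : C -> C) (p : C) :
  smooth f p -> smooth g p -> smooth (fun z => f z + g z) p.
Proof. intros Hf Hg n. now apply (@jet_add n (fun h => f (p + h))). Qed.

Lemma smooth_mul (f g : C -> C) (p : C) :
  smooth f p -> smooth g p -> smooth (fun z => f z * g z) p.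
Proof. intros Hf Hg n. now apply (@jet_mul n (fun h => f (p + h))). Qed.

Lemma smooth_inv (f : C -> C) (p : C) :
  smooth f p -> f p <> 0 -> smooth (fun z => / f z) p.
Proof.
  intros Hf H0 n. apply (@jet_inv n (fun h => f (p + h))); auto.
  now rewrite Cplus_0_r.
Qed.

Lemma smooth_ext (f g : C -> C) (p : C) :
  near0 (fun h => f (p + h) = g (p + h)) -> smooth f p -> smooth g p.
Proof. intros E Hf n. now apply jet_ext with (fun h => f (p + h)). Qed.

Lemma smooth_close (f : C -> C) (p : C) (eps : R) :
  smooth f p -> (0 < eps)%R ->
  near0 (fun h => (Cmod (f (p + h)%C - f p) < eps)%R).
Proof.
  intros Hf He. pose proof (@jet1_close _ eps (Hf 1%nat) He) as H.
  cbv beta in H. now rewrite Cplus_0_r in H.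
Qed.

(** * Convergent power series *)

(** The first [n] terms, so that the empty sum is included, unlike in [sum_n]. *)
Fixpoint psum (a : nat -> C) (h : C) (n : nat) : C :=
  match n with
  | O => 0
  | S m => psum a h m + a m * h ^ m
  end.

Definition psums_to (a : nat -> C) (h l : C) : Prop :=
  forall eps : R, (0 < eps)%R ->
    exists N : nat, forall n : nat, (N <= n)%nat ->
      (Cmod (psum a h n - l) < eps)%R.

Lemma pow_n_Cpow (h : C) (n : nat) : @pow_n C_Ring h n = h ^ n.
Proof. induction n as [|n IH]; [reflexivity|]. simpl. now rewrite IH. Qed.

Lemma sum_n_psum (a : nat -> C) (h : C) (n : nat) :
  sum_n (G := C_AbelianMonoid) (fun k => scal (V := C_ModuleSpace)(pow_n (K := C_Ring) h k) (a k)) n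
  = psum a h (S n).
Proof.
  induction n as [|n IH].
  - rewrite sum_O. cbn -[Cmult Cplus]. change (1 * a 0%nat = 0 + a 0%nat * 1). ring.
  - rewrite sum_Sn, IH. rewrite (pow_n_Cpow h (S n)).
    change (psum a h (S n) + h ^ S n * a (S n) = psum a h (S n) + a (S n) * h ^ S n).
    ring.
Qed.

Lemma is_pseries_psums (a : nat -> C) (h l : C) :
  is_pseries (K := C_AbsRing) (V := C_NormedModule) a h l <-> psums_to a h l.
Proof.
  unfold is_pseries, is_series.
  rewrite (filterlim_locally (U := C_UniformSpace) _ l). split.
  - intros H eps He.
    destruct (H (mkposreal (eps / 2) ltac:(lra))) as [N HN].
    exists (S N). intros [|n] Hn; [lia|].
    specialize (HN n ltac:(lia)).
    apply C_NormedModule_mixin_compat2 in HN. simpl in HN.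
    rewrite <- sum_n_psum.
    eapply Rlt_le_trans; [exact HN|].
    assert (sqrt 2 <= 2)%R.
    { rewrite <- (sqrt_Rsqr 2) at 2 by lra. apply sqrt_le_1_alt.
      unfold Rsqr. lra. }
    nra.
  - intros H eps. destruct (H eps (cond_pos eps)) as [N HN].
    exists N. intros n Hn. apply C_NormedModule_mixin_compat1.
    specialize (HN (S n) ltac:(lia)). now rewrite <- sum_n_psum in HN.
Qed.

Lemma psum_S (a : nat -> C) (h : C) (n : nat) :
  psum a h (S n) = a 0%nat + h * psum (fun k => a (S k)) h n.
Proof.
  induction n as [|n IH]; [simpl; ring|].
  change (psum a h (S (S n))) with (psum a h (S n) + a (S n) * h ^ S n).
  rewrite IH. simpl. ring.
Qed.

Lemma psums_dist (a : nat -> C) (h l w : C) (B : R) :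
  psums_to a h l -> (exists N, forall n, (N <= n)%nat -> (Cmod (psum a h n - w) <= B)%R) ->
  (Cmod (l - w) <= B)%R.
Proof.
  intros H [N1 HB]. apply Rnot_lt_le. intros Hc.
  destruct (H (Cmod (l - w) - B)%R ltac:(lra)) as [N HN].
  specialize (HN (N + N1)%nat ltac:(lia)). specialize (HB (N + N1)%nat ltac:(lia)).
  pose proof (Cmod_triangle (psum a h (N + N1) - w) (- (psum a h (N + N1) - l))) as Ht.
  rewrite Cmod_opp in Ht.
  replace (psum a h (N + N1) - w + - (psum a h (N + N1) - l)) with (l - w) in Ht by ring.
  lra.
Qed.

Lemma Cmod_sub_le0 (x y : C) : (Cmod (x - y) <= 0)%R -> x = y.
Proof.
  intros H. assert (E : x - y = 0).
  { apply Cmod_eq_0. apply Rle_antisym; [exact H | apply Cmod_ge_0]. }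
  replace x with (x - y + y) by ring. rewrite E. ring.
Qed.

Lemma psums_at_0_unique (a : nat -> C) (l : C) : psums_to a 0 l -> l = a 0%nat.
Proof.
  intros H. apply Cmod_sub_le0. apply psums_dist with (1 := H).
  exists 1%nat. intros [|n] Hn; [lia|].
  rewrite psum_S. right.
  replace (a 0%nat + 0 * _ - a 0%nat) with (RtoC 0) by ring. apply Cmod_0.
Qed.

Lemma psums_to_at_0 (a : nat -> C) : psums_to a 0 (a 0%nat).
Proof.
  intros eps He. exists 1%nat. intros [|n] Hn; [lia|].
  rewrite psum_S.
  replace (a 0%nat + 0 * _ - a 0%nat) with (RtoC 0) by ring. now rewrite Cmod_0.
Qed.

Lemma psums_shift (a : nat -> C) (h l : C) :
  h <> 0 -> psums_to a h l -> psums_to (fun n => a (S n)) h ((l - a 0%nat) / h).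
Proof.
  intros Hh H eps He. pose proof (proj1 (Cmod_gt_0 _) Hh) as Hp.
  destruct (H (eps * Cmod h)%R ltac:(now apply Rmult_lt_0_compat)) as [N HN].
  exists N. intros n Hn. specialize (HN (S n) ltac:(lia)).
  rewrite psum_S in HN.
  apply Rmult_lt_reg_r with (Cmod h); [exact Hp|].
  rewrite <- Cmod_mult. eapply Rle_lt_trans; [|exact HN].
  right. f_equal. field. exact Hh.
Qed.

Lemma psums_terms (a : nat -> C) (h l : C) :
  psums_to a h l -> exists M : R, (0 < M)%R /\ forall n, (Cmod (a n) * Cmod h ^ n <= M)%R.
Proof.
  intros H. destruct (H 1%R Rlt_0_1) as [N HN].
  assert (Hfin : exists M : R, (0 < M)%R /\
            forall n, (n < N)%nat -> (Cmod (a n) * Cmod h ^ n <= M)%R).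
  { clear HN. induction N as [|N [M [HM IH]]].
    - exists 1%R. split; [lra|]. intros; lia.
    - exists (Rmax M (Cmod (a N) * Cmod h ^ N)). split.
      + eapply Rlt_le_trans; [exact HM | apply Rmax_l].
      + intros n Hn. destruct (Nat.eq_dec n N) as [->|Hne]; [apply Rmax_r|].
        eapply Rle_trans; [apply IH; lia | apply Rmax_l]. }
  destruct Hfin as [M [HM Hfin]]. exists (M + 2)%R. split; [lra|]. intros n.
  destruct (Nat.lt_ge_cases n N) as [Hn|Hn].
  - specialize (Hfin n Hn). lra.
  - pose proof (HN n Hn) as H1. pose proof (HN (S n) ltac:(lia)) as H2.
    rewrite <- Cmod_pow, <- Cmod_mult.
    pose proof (Cmod_triangle (psum a h (S n) - l) (- (psum a h n - l))) as Ht.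
    rewrite Cmod_opp in Ht. simpl in Ht, H2.
    replace (psum a h n + a n * h ^ n - l + - (psum a h n - l))
      with (a n * h ^ n) in Ht by ring.
    lra.
Qed.

Lemma psum_bound (a : nat -> C) (h : C) (M rho : R) :
  (0 < rho)%R -> (forall n, (Cmod (a n) * rho ^ n <= M)%R) ->
  (Cmod h <= rho / 2)%R -> forall n, (Cmod (psum a h n) <= 2 * M)%R.
Proof.
  intros Hr HM Hh n.
  assert (H0 : (0 <= M)%R).
  { pose proof (HM 0%nat) as H. simpl in H. pose proof (Cmod_ge_0 (a 0%nat)). lra. }
  apply Rle_trans with (2 * M * (1 - (/ 2) ^ n))%R.
  - induction n as [|n IH].
    + simpl. rewrite Cmod_0. lra.
    + simpl psum. eapply Rle_trans; [apply Cmod_triangle|].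
      assert (Hn : (Cmod (a n * h ^ n) <= M * (/ 2) ^ n)%R).
      { rewrite Cmod_mult, Cmod_pow.
        apply Rle_trans with (Cmod (a n) * (rho * / 2) ^ n)%R.
        - apply Rmult_le_compat_l; [apply Cmod_ge_0|].
          apply pow_incr. split; [apply Cmod_ge_0 | exact Hh].
        - rewrite Rpow_mult_distr, <- Rmult_assoc.
          apply Rmult_le_compat_r; [apply pow_le; lra | apply HM]. }
      simpl pow. lra.
  - pose proof (pow_le (/ 2) n ltac:(lra)). nra.
Qed.

Definition has_pseries (a : nat -> C) (delta : R) (f : C -> C) : Prop :=
  (0 < delta)%R /\ forall h : C, (Cmod h < delta)%R -> psums_to a h (f h).

(** The shifted coefficients converge to the difference quotient, so a power series has
    finite expansions of every order. *)
Lemma has_pseries_shift (a : nat -> C) (delta : R) (f : C -> C) :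
  has_pseries a delta f ->
  exists g : C -> C, has_pseries (fun n => a (S n)) delta g /\
    forall h, (Cmod h < delta)%R -> f h = a 0%nat + h * g h.
Proof.
  intros [Hd H].
  exists (fun h => if Ceq_dec h 0 then a 1%nat else (f h - a 0%nat) / h).
  split.
  - split; [exact Hd|]. intros h Hh. destruct (Ceq_dec h 0) as [->|Hn].
    + apply (psums_to_at_0 (fun n => a (S n))).
    + now apply psums_shift; auto.
  - intros h Hh. destruct (Ceq_dec h 0) as [->|Hn].
    + rewrite (psums_at_0_unique (H 0 Hh)). ring.
    + field. exact Hn.
Qed.

Lemma has_pseries_terms (a : nat -> C) (delta : R) (f : C -> C) :
  has_pseries a delta f ->
  exists M : R, (0 < M)%R /\ forall n, (Cmod (a n) * (delta / 2) ^ n <= M)%R.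
Proof.
  intros [Hd H].
  assert (E : Cmod (RtoC (delta / 2)) = (delta / 2)%R).
  { rewrite Cmod_R. apply Rabs_pos_eq. lra. }
  rewrite <- E. apply psums_terms with (f (RtoC (delta / 2))). apply H. lra.
Qed.

Lemma has_pseries_jet (n : nat) (a : nat -> C) (delta : R) (f : C -> C) :
  has_pseries a delta f -> jet n f.
Proof.
  revert a f. induction n as [|n IH]; intros a f H.
  - destruct (has_pseries_terms H) as [M [HM Ht]]. destruct H as [Hd H].
    exists (2 * M)%R. split; [lra|]. exists (delta / 4)%R. split; [lra|].
    intros h Hh.
    replace (f h) with (f h - 0) by ring.
    apply psums_dist with a h; [apply H; lra|]. exists 0%nat. intros m _.
    replace (psum a h m - 0) with (psum a h m) by ring.
    apply psum_bound with (delta / 2)%R; auto; lra.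
  - destruct (has_pseries_shift H) as [g [Hg E]].
    exists (a 0%nat), g. split; [now apply IH with (fun n => a (S n))|].
    exists delta. split; [apply H | exact E].
Qed.

(** * Termwise differentiation *)

(** The factor [rho ^ 2] on the left avoids the exponent [n - 2] in the usual estimate of
    the second order remainder of a power. *)
Lemma power_remainder (h k : C) (rho : R) (n : nat) :
  (Cmod h + Cmod k <= rho)%R ->
  (rho ^ 2 * Cmod ((h + k) ^ n - h ^ n - INR n * h ^ pred n * k)
   <= INR n ^ 2 * rho ^ n * Cmod k ^ 2)%R.
Proof.
  intros Hr. pose proof (Cmod_ge_0 h) as Hh. pose proof (Cmod_ge_0 k) as Hk.
  induction n as [|n IH].
  - simpl. right. replace (1 - 1 - 0 * 1 * k) with (RtoC 0) by ring.
    rewrite Cmod_0. ring.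
  - set (E := (h + k) ^ n - h ^ n - INR n * h ^ pred n * k) in *.
    replace ((h + k) ^ S n - h ^ S n - INR (S n) * h ^ pred (S n) * k)
      with ((h + k) * E + INR n * h ^ pred n * k ^ 2).
    2:{ unfold E. rewrite S_INR, RtoC_plus. destruct n as [|n]; simpl; ring. }
    pose proof (pos_INR n) as Hn.
    apply Rle_trans with (rho ^ 2 * (rho * Cmod E) + INR n * rho ^ S n * Cmod k ^ 2)%R.
    + eapply Rle_trans.
      { apply Rmult_le_compat_l; [apply pow2_ge_0 | apply Cmod_triangle]. }
      rewrite Rmult_plus_distr_l. apply Rplus_le_compat.
      * apply Rmult_le_compat_l; [apply pow2_ge_0|].
        rewrite Cmod_mult. apply Rmult_le_compat_r; [apply Cmod_ge_0|].
        eapply Rle_trans; [apply Cmod_triangle | exact Hr].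
      * rewrite !Cmod_mult, !Cmod_pow, Cmod_R, Rabs_pos_eq by exact Hn.
        destruct n as [|n]; [simpl; lra|].
        replace (rho ^ 2 * (INR (S n) * Cmod h ^ pred (S n) * Cmod k ^ 2))%R
          with (INR (S n) * Cmod k ^ 2 * rho ^ 2 * Cmod h ^ n)%R by (simpl; ring).
        replace (INR (S n) * rho ^ S (S n) * Cmod k ^ 2)%R
          with (INR (S n) * Cmod k ^ 2 * rho ^ 2 * rho ^ n)%R by (simpl; ring).
        apply Rmult_le_compat_l.
        -- apply Rmult_le_pos; [apply Rmult_le_pos; [exact Hn|]|]; apply pow2_ge_0.
        -- apply pow_incr. lra.
    + rewrite S_INR.
      assert (H1 : (rho * (rho ^ 2 * Cmod E)
              <= rho * (INR n ^ 2 * rho ^ n * Cmod k ^ 2))%R)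
        by (apply Rmult_le_compat_l; lra).
      assert (H2 : (0 <= (INR n + 1) * rho ^ S n * Cmod k ^ 2)%R).
      { apply Rmult_le_pos; [|apply pow2_ge_0].
        apply Rmult_le_pos; [lra | apply pow_le; lra]. }
      simpl in *. nra.
Qed.

Definition dcoef (a : nat -> C) (n : nat) : C := INR (S n) * a (S n).

Lemma INR_le_pow2 (n : nat) : (INR (S n) <= 2 ^ n)%R.
Proof.
  induction n as [|n IH]; [simpl; lra|].
  rewrite S_INR. pose proof (pow_R1_Rle 2 n ltac:(lra)). simpl pow. lra.
Qed.

Lemma psum_taylor1 (a : nat -> C) (h k : C) (n : nat) :
  psum a (h + k) (S n) - psum a h (S n) - k * psum (dcoef a) h n
  = psum (fun j => a j * ((h + k) ^ j - h ^ j - INR j * h ^ pred j * k)) 1 (S n).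
Proof.
  induction n as [|n IH].
  - simpl. ring.
  - change (psum ?b ?x (S (S n))) with (psum b x (S n) + b (S n) * x ^ S n).
    rewrite Cpow_1_l.
    change (psum (dcoef a) h (S n)) with (psum (dcoef a) h n + dcoef a n * h ^ n).
    transitivity (psum a (h + k) (S n) - psum a h (S n) - k * psum (dcoef a) h n
      + a (S n) * ((h + k) ^ S n - h ^ S n - INR (S n) * h ^ n * k)).
    + unfold dcoef. ring.
    + rewrite IH. simpl pred. ring.
Qed.

(** A geometric decay of ratio [1/8] absorbs [n ^ 2 <= 4 ^ n] and still leaves the ratio
    [1/2]. *)
Lemma scaled_terms (x M rho : R) (n : nat) :
  (0 <= x)%R -> (0 < rho)%R -> (x * (8 * rho) ^ n <= M)%R ->
  (x * (INR n ^ 2 * rho ^ n) <= M * (/ 2) ^ n)%R.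
Proof.
  intros Hx Hr H.
  assert (Hn : (INR n ^ 2 <= 4 ^ n)%R).
  { replace 4%R with (2 * 2)%R by lra. rewrite Rpow_mult_distr.
    pose proof (INR_le_pow2 n) as H1. rewrite S_INR in H1. pose proof (pos_INR n).
    simpl. nra. }
  apply Rle_trans with (x * (4 ^ n * rho ^ n))%R.
  - apply Rmult_le_compat_l; [exact Hx|].
    apply Rmult_le_compat_r; [apply pow_le; lra | exact Hn].
  - replace (x * (4 ^ n * rho ^ n))%R with (x * (8 * rho) ^ n * (/ 2) ^ n)%R.
    + apply Rmult_le_compat_r; [apply pow_le; lra | exact H].
    + rewrite Rmult_assoc, <- !Rpow_mult_distr. do 2 f_equal. field.
Qed.

(** The limit is obtained from the completeness of [C], by comparison with a geometric
    series. *)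
Lemma psums_dcoef (a : nat -> C) (h : C) (M rho : R) :
  (0 < rho)%R -> (forall n, (Cmod (a n) * (8 * rho) ^ n <= M)%R) ->
  (Cmod h < rho)%R -> exists l : C, psums_to (dcoef a) h l.
Proof.
  intros Hr HM Hh.
  assert (Hex : ex_series (K := C_AbsRing) (V := C_CompleteNormedModule)
    (fun n => scal (V := C_ModuleSpace) (pow_n (K := C_Ring) h n) (dcoef a n))).
  { apply ex_series_le with (fun n => (M / (8 * rho)) * (/ 2) ^ n)%R.
    - intros n.
      change (Cmod (@pow_n C_Ring h n * dcoef a n) <= M / (8 * rho) * (/ 2) ^ n)%R.
      rewrite pow_n_Cpow, Cmod_mult, Cmod_pow. unfold dcoef.
      rewrite Cmod_mult, Cmod_R, Rabs_pos_eq by apply pos_INR.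
      apply Rmult_le_reg_r with (8 * rho)%R; [lra|].
      replace (M / (8 * rho) * (/ 2) ^ n * (8 * rho))%R with (M * (/ 2) ^ n)%R
        by (field; lra).
      apply Rle_trans with (rho ^ n * (2 ^ n * Cmod (a (S n))) * (8 * rho))%R.
      + apply Rmult_le_compat_r; [lra|].
        apply Rmult_le_compat.
        * apply pow_le, Cmod_ge_0.
        * apply Rmult_le_pos; [apply pos_INR | apply Cmod_ge_0].
        * apply pow_incr. split; [apply Cmod_ge_0 | lra].
        * apply Rmult_le_compat_r; [apply Cmod_ge_0 | apply INR_le_pow2].
      + replace (rho ^ n * (2 ^ n * Cmod (a (S n))) * (8 * rho))%R
          with (Cmod (a (S n)) * (8 * rho) ^ S n * (/ 4) ^ n)%R.
        * apply Rle_trans with (M * (/ 4) ^ n)%R.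
          -- apply Rmult_le_compat_r; [apply pow_le; lra | apply HM].
          -- apply Rmult_le_compat_l.
             ++ pose proof (HM 0%nat) as H. simpl in H.
                pose proof (Cmod_ge_0 (a 0%nat)). lra.
             ++ apply pow_incr. lra.
        * simpl pow.
          replace (rho ^ n * (2 ^ n * Cmod (a (S n))) * (8 * rho))%R
            with (Cmod (a (S n)) * (8 * rho) * (rho ^ n * 2 ^ n))%R by ring.
          replace (Cmod (a (S n)) * (8 * rho * (8 * rho) ^ n) * (/ 4) ^ n)%R
            with (Cmod (a (S n)) * (8 * rho) * ((8 * rho) ^ n * (/ 4) ^ n))%R by ring.
          rewrite <- !Rpow_mult_distr. do 2 f_equal. field.
    - apply (ex_series_scal_l (K := R_AbsRing) (V := R_NormedModule)).
      apply ex_series_geom. rewrite Rabs_pos_eq; lra. }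
  destruct Hex as [l Hl]. exists l. apply is_pseries_psums. exact Hl.
Qed.

Lemma C_derive_of_quadratic (f : C -> C) (z l : C) (K d : R) :
  (0 < d)%R -> (0 <= K)%R ->
  (forall k, (Cmod k < d)%R -> (Cmod (f (z + k)%C - f z - k * l) <= K * Cmod k ^ 2)%R) ->
  C_derive f z = l.
Proof.
  intros Hd HK H. apply is_C_lim_unique. apply filterlim_locally. intros eps.
  set (d' := Rmin d (eps / (K + 1))).
  assert (Hd' : (0 < d')%R).
  { apply Rmin_glb_lt; [exact Hd|]. apply Rdiv_lt_0_compat; [apply cond_pos | lra]. }
  apply (locally_le_locally_norm (K := C_AbsRing) (V := C_NormedModule)).
  exists (mkposreal d' Hd').
  cut (forall x : C, (Cmod (x - z) < d')%R -> x <> z ->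
         ball (M := C_UniformSpace) l eps ((f x - f z) / (x - z))).
  { intros Hg x Hx Hne. exact (Hg x Hx Hne). }
  intros x Hx Hne.
  assert (Hnz : x - z <> 0).
  { intros Hc. apply Hne. apply Cmod_sub_le0. rewrite Hc, Cmod_0. lra. }
  pose proof (proj1 (Cmod_gt_0 _) Hnz) as Hp.
  apply C_NormedModule_mixin_compat1.
  change (Cmod ((f x - f z) / (x - z) - l) < eps)%R.
  assert (H1 : (Cmod (x - z) < d)%R) by (eapply Rlt_le_trans; [exact Hx | apply Rmin_l]).
  assert (H2 : (Cmod (x - z) < eps / (K + 1))%R)
    by (eapply Rlt_le_trans; [exact Hx | apply Rmin_r]).
  specialize (H (x - z) H1). replace (z + (x - z)) with x in H by ring.
  apply Rmult_lt_reg_r with (Cmod (x - z)); [exact Hp|].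
  rewrite <- Cmod_mult.
  replace (((f x - f z) / (x - z) - l) * (x - z)) with (f x - f z - (x - z) * l)
    by (field; exact Hnz).
  eapply Rle_lt_trans; [exact H|].
  assert (H3 : ((K + 1) * Cmod (x - z) < eps)%R).
  { apply Rmult_lt_reg_r with (/ (K + 1))%R; [apply Rinv_0_lt_compat; lra|].
    eapply Rle_lt_trans; [|exact H2]. right. field. lra. }
  nra.
Qed.

(** Termwise differentiation. Subtracting the linear part termwise leaves a series whose
    terms are bounded by [power_remainder], hence an error of order [k ^ 2] in the
    increment of [f], uniformly in the number of terms. *)
Lemma has_pseries_derive (a : nat -> C) (delta : R) (f : C -> C) (z : C) :
  has_pseries a delta (fun h => f (z + h)) ->
  exists delta' : R, has_pseries (dcoef a) delta' (fun h => C_derive f (z + h)).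
Proof.
  intros H. destruct (has_pseries_terms H) as [M [HM Ht]]. destruct H as [Hd H].
  (* [8 * rho = delta / 2] is inside the disk of convergence; the factor 8 is the
     room that [scaled_terms] asks for *)
  set (rho := (delta / 16)%R). assert (Hr : (0 < rho)%R) by (unfold rho; lra).
  replace (delta / 2)%R with (8 * rho)%R in Ht by (unfold rho; field).
  exists rho. split; [exact Hr|]. intros h Hh.
  destruct (psums_dcoef Hr Ht Hh) as [l Hl].
  replace (C_derive f (z + h)) with l; [exact Hl|]. symmetry.
  apply C_derive_of_quadratic with (2 * M / rho ^ 2)%R (rho - Cmod h)%R.
  - lra.
  - apply Rmult_le_pos; [lra|]. left. apply Rinv_0_lt_compat. now apply pow_lt.
  - intros k Hk.
    assert (Hhk : (Cmod (h + k) < delta)%R).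
    { eapply Rle_lt_trans; [apply Cmod_triangle|]. unfold rho in *. lra. }
    pose proof (H _ Hhk) as S1. pose proof (H h ltac:(unfold rho in *; lra)) as S2.
    replace (z + h + k) with (z + (h + k)) by ring.
    set (F := f (z + (h + k))) in *. set (G := f (z + h)) in *.
    apply Rnot_lt_le. intros Hc.
    set (e := (Cmod (F - G - k * l) - 2 * M / rho ^ 2 * Cmod k ^ 2)%R) in *.
    assert (He : (0 < e)%R) by (unfold e; lra).
    pose proof (Cmod_ge_0 k) as Hk0.
    assert (He' : (0 < e / (3 + Cmod k))%R) by (apply Rdiv_lt_0_compat; lra).
    (* [e] is the excess to be refuted, shared among the two values of [f] and [k * l] *)
    set (e' := (e / (3 + Cmod k))%R) in *.
    destruct (S1 e' He') as [N1 H1]. destruct (S2 e' He') as [N2 H2].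
    destruct (Hl e' He') as [N3 H3].
    set (n := (N1 + N2 + N3)%nat).
    specialize (H1 (S n) ltac:(lia)). specialize (H2 (S n) ltac:(lia)).
    specialize (H3 n ltac:(lia)).
    pose proof (psum_taylor1 a h k n) as Hid.
    assert (Hb : (Cmod (psum a (h + k) (S n) - psum a h (S n) - k * psum (dcoef a) h n)
                  <= 2 * (M / rho ^ 2 * Cmod k ^ 2))%R).
    { rewrite Hid. apply psum_bound with 2%R; [lra| |rewrite Cmod_1; lra].
      intros j. rewrite Cmod_mult.
      assert (Hpr := @power_remainder h k rho j ltac:(lra)).
      apply Rmult_le_reg_l with (rho ^ 2)%R; [now apply pow_lt|].
      replace (rho ^ 2 * (M / rho ^ 2 * Cmod k ^ 2))%R with (M * Cmod k ^ 2)%R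
        by (field; lra).
      replace (rho ^ 2 * (Cmod (a j) * Cmod ((h + k) ^ j - h ^ j - INR j * h ^ pred j * k) * 2 ^ j))%R
        with (Cmod (a j) * (rho ^ 2 * Cmod ((h + k) ^ j - h ^ j - INR j * h ^ pred j * k)) * 2 ^ j)%R
        by ring.
      apply Rle_trans with (Cmod (a j) * (INR j ^ 2 * rho ^ j * Cmod k ^ 2) * 2 ^ j)%R.
      - apply Rmult_le_compat_r; [apply pow_le; lra|].
        apply Rmult_le_compat_l; [apply Cmod_ge_0 | exact Hpr].
      - pose proof (@scaled_terms _ _ _ j (Cmod_ge_0 (a j)) Hr (Ht j)) as Hs.
        apply Rle_trans with (M * (/ 2) ^ j * (2 ^ j * Cmod k ^ 2))%R.
        + replace (Cmod (a j) * (INR j ^ 2 * rho ^ j * Cmod k ^ 2) * 2 ^ j)%R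
            with (Cmod (a j) * (INR j ^ 2 * rho ^ j) * (2 ^ j * Cmod k ^ 2))%R by ring.
          apply Rmult_le_compat_r; [|exact Hs].
          apply Rmult_le_pos; [apply pow_le; lra | apply pow2_ge_0].
        + right. replace (M * (/ 2) ^ j * (2 ^ j * Cmod k ^ 2))%R
            with (M * Cmod k ^ 2 * ((/ 2) ^ j * 2 ^ j))%R by ring.
          rewrite <- Rpow_mult_distr. replace (/ 2 * 2)%R with 1%R by field.
          rewrite pow1. ring. }
    assert (Hsplit : (Cmod (F - G - k * l) <=
       Cmod (psum a (h + k) (S n) - psum a h (S n) - k * psum (dcoef a) h n)
       + Cmod (psum a (h + k) (S n) - F) + Cmod (psum a h (S n) - G)
       + Cmod k * Cmod (psum (dcoef a) h n - l))%R).
    { set (A := psum a (h + k) (S n)) in *. set (B := psum a h (S n)) in *.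
      set (D := psum (dcoef a) h n) in *.
      replace (F - G - k * l) with
        ((A - B - k * D) + - (A - F) + (B - G) + k * (D - l)) by ring.
      rewrite <- (Cmod_opp (A - F)), <- Cmod_mult.
      eapply Rle_trans; [apply Cmod_triangle|]. apply Rplus_le_compat_r.
      eapply Rle_trans; [apply Cmod_triangle|]. apply Rplus_le_compat_r.
      apply Cmod_triangle. }
    assert (Hke : (Cmod k * Cmod (psum (dcoef a) h n - l) <= Cmod k * e')%R)
      by (apply Rmult_le_compat_l; lra).
    assert (Hee : ((3 + Cmod k) * e' = e)%R) by (unfold e'; field; lra).
    replace (2 * (M / rho ^ 2 * Cmod k ^ 2))%R with (2 * M / rho ^ 2 * Cmod k ^ 2)%R
      in Hb by (field; lra).
    unfold e in Hee. nra.
Qed.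

(** * The maximum principle *)

(** Compactness in the form of a uniform gauge: shrinking the radius at each point below
    the inverse of the local bound turns a lower bound of the gauge into a global bound of
    the function. *)
Lemma locally_bounded_on_disk (F : C -> R) (R0 : R) :
  (forall p, (Cmod p <= R0)%R -> exists d M : R, (0 < d)%R /\
     forall z, (Cmod z <= R0)%R -> (Cmod (z - p) < d)%R -> (F z <= M)%R) ->
  exists M : R, forall z, (Cmod z <= R0)%R -> (F z <= M)%R.
Proof.
  intros H.
  assert (Hdelta : forall u v : R, exists delta : posreal, forall z,
    (Cmod z <= R0)%R -> (Cmod (z - (u, v)) < 2 * delta)%R -> (F z <= / delta)%R).
  { intros u v. set (p := (u, v) : C).
    destruct (Rle_lt_dec (Cmod p) R0) as [Hp|Hp].
    - destruct (H p Hp) as [d [M [Hd HM]]].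
      assert (HK : (0 < / (Rabs M + 1))%R).
      { apply Rinv_0_lt_compat. pose proof (Rabs_pos M). lra. }
      assert (Hm : (0 < Rmin (d / 2) (/ (Rabs M + 1)))%R)
        by (apply Rmin_glb_lt; [lra | exact HK]).
      exists (mkposreal _ Hm). cbn [pos]. intros z Hz Hzp.
      pose proof (Rmin_l (d / 2) (/ (Rabs M + 1))) as H1.
      pose proof (Rmin_r (d / 2) (/ (Rabs M + 1))) as H2.
      apply Rle_trans with M; [apply HM; auto; lra|].
      apply Rle_trans with (Rabs M + 1)%R; [pose proof (Rle_abs M); lra|].
      rewrite <- (Rinv_inv (Rabs M + 1)) at 1. now apply Rinv_le_contravar.
    - assert (Hm : (0 < (Cmod p - R0) / 2)%R) by lra.
      exists (mkposreal _ Hm). cbn [pos]. intros z Hz Hzp. exfalso.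
      pose proof (Cmod_triangle z (- (z - p))) as Ht. rewrite Cmod_opp in Ht.
      replace (z + - (z - p)) with p in Ht by ring. change (u, v) with p in Hzp. lra. }
  set (delta := fun u v => proj1_sig (constructive_indefinite_description _ (Hdelta u v))).
  assert (Hd : forall u v z, (Cmod z <= R0)%R -> (Cmod (z - (u, v)) < 2 * delta u v)%R ->
                 (F z <= / delta u v)%R).
  { intros u v. exact (proj2_sig (constructive_indefinite_description _ (Hdelta u v))). }
  destruct (compactness_value_2d (- R0) R0 (- R0) R0 delta) as [d Hc].
  exists (/ d)%R. intros z Hz.
  pose proof (Rmax_Cmod z) as Hmx.
  pose proof (Rmax_l (Rabs (fst z)) (Rabs (snd z))) as H1.
  pose proof (Rmax_r (Rabs (fst z)) (Rabs (snd z))) as H2.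
  assert (Hx : (- R0 <= fst z <= R0)%R) by (apply Rabs_le_between; lra).
  assert (Hy : (- R0 <= snd z <= R0)%R) by (apply Rabs_le_between; lra).
  apply NNPP. intros Hn. apply (Hc _ _ Hx Hy). intros [u [v [_ [_ [Hu [Hv Hdd]]]]]].
  apply Hn. pose proof (cond_pos d) as Hdp.
  apply Rle_trans with (/ delta u v)%R; [|now apply Rinv_le_contravar].
  apply Hd; [exact Hz|].
  eapply Rle_lt_trans; [apply Cmod_2Rmax|].
  change (fst (z - (u, v))) with (fst z - u)%R.
  change (snd (z - (u, v))) with (snd z - v)%R.
  assert (Hs : (sqrt 2 <= 2)%R).
  { rewrite <- (sqrt_Rsqr 2) at 2 by lra. apply sqrt_le_1_alt. unfold Rsqr. lra. }
  assert (Hm : (Rmax (Rabs (fst z - u)) (Rabs (snd z - v)) < delta u v)%R)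
    by now apply Rmax_lub_lt.
  assert (H0 : (0 <= Rmax (Rabs (fst z - u)) (Rabs (snd z - v)))%R).
  { eapply Rle_trans; [apply Rabs_pos | apply Rmax_l]. }
  nra.
Qed.

(** If the supremum [M] were not attained, [/ (M - F)] would be locally bounded, hence
    bounded, and a number smaller than [M] would bound [F]. *)
Lemma max_on_disk (F : C -> R) (R0 : R) :
  (0 <= R0)%R ->
  (forall p eps, (Cmod p <= R0)%R -> (0 < eps)%R -> exists d : R, (0 < d)%R /\
     forall z, (Cmod (z - p) < d)%R -> (Rabs (F z - F p) < eps)%R) ->
  exists p, (Cmod p <= R0)%R /\ forall z, (Cmod z <= R0)%R -> (F z <= F p)%R.
Proof.
  intros HR Hcont.
  assert (Hbd : exists M : R, forall z, (Cmod z <= R0)%R -> (F z <= M)%R).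
  { apply locally_bounded_on_disk. intros p Hp.
    destruct (Hcont p 1%R Hp Rlt_0_1) as [d [Hd H]].
    exists d, (F p + 1)%R. split; [exact Hd|]. intros z _ Hz.
    specialize (H z Hz). apply Rabs_def2 in H. lra. }
  destruct Hbd as [M0 HM0].
  destruct (completeness (fun x => exists z, (Cmod z <= R0)%R /\ x = F z)) as [M [HM1 HM2]].
  - exists M0. intros x [z [Hz ->]]. auto.
  - exists (F 0), 0. rewrite Cmod_0. now split.
  - apply NNPP. intros Hno.
    assert (Hlt : forall z, (Cmod z <= R0)%R -> (F z < M)%R).
    { intros z Hz. apply Rnot_le_lt. intros Hc. apply Hno. exists z. split; [exact Hz|].
      intros w Hw. apply Rle_trans with M; [|exact Hc]. apply HM1. now exists w. }
    assert (HG : exists K : R, forall z, (Cmod z <= R0)%R -> (/ (M - F z) <= K)%R).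
    { apply (@locally_bounded_on_disk (fun z => / (M - F z))%R). intros p Hp.
      pose proof (Hlt p Hp) as Hpl.
      destruct (Hcont p ((M - F p) / 2)%R Hp ltac:(lra)) as [d [Hd H]].
      exists d, (/ ((M - F p) / 2))%R. split; [exact Hd|]. intros z Hz Hzp.
      specialize (H z Hzp). apply Rabs_def2 in H.
      apply Rinv_le_contravar; lra. }
    destruct HG as [K HK].
    assert (HKp : (0 < K)%R).
    { eapply Rlt_le_trans; [|apply (HK 0); rewrite Cmod_0; exact HR].
      apply Rinv_0_lt_compat. specialize (Hlt 0). rewrite Cmod_0 in Hlt. lra. }
    assert (HM3 : (M <= M - / K)%R).
    { apply HM2. intros x [z [Hz ->]]. specialize (HK z Hz). specialize (Hlt z Hz).
      assert (/ K <= M - F z)%R; [|lra].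
      rewrite <- (Rinv_inv (M - F z)). apply Rinv_le_contravar; [|exact HK].
      apply Rinv_0_lt_compat. lra. }
    pose proof (Rinv_0_lt_compat _ HKp). lra.
Qed.

Lemma Cmod_sqr_close (x y : C) :
  (Rabs (Cmod x ^ 2 - Cmod y ^ 2) <= Cmod (x - y) * (2 * Cmod y + Cmod (x - y)))%R.
Proof.
  pose proof (Cmod_triangle (x - y) y) as H1.
  pose proof (Cmod_triangle x (- (x - y))) as H2. rewrite Cmod_opp in H2.
  replace (x - y + y) with x in H1 by ring.
  replace (x + - (x - y)) with y in H2 by ring.
  pose proof (Cmod_ge_0 x). pose proof (Cmod_ge_0 y). pose proof (Cmod_ge_0 (x - y)).
  apply Rabs_le. nra.
Qed.

(** Parseval's identity over the fourth roots of unity; four points suffice because the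
    exponents [0], [1], [2] are distinct modulo four. *)
Lemma four_point_mean (a0 a1 a2 : C) (t : R) :
  let L := fun u => a0 + a1 * (t * u) + a2 * (t * u) ^ 2 in
  (Cmod (L 1) ^ 2 + Cmod (L Ci) ^ 2 + Cmod (L (- (1))%C) ^ 2 + Cmod (L (- Ci)%C) ^ 2
   = 4 * (Cmod a0 ^ 2 + t ^ 2 * Cmod a1 ^ 2 + t ^ 4 * Cmod a2 ^ 2))%R.
Proof.
  intros L. unfold L. rewrite !Cmod2_alt. destruct a0 as [x0 y0], a1 as [x1 y1], a2 as [x2 y2].
  unfold Re, Im. simpl. ring.
Qed.

(** Averaging over the points [t], [i t], [- t], [- i t] raises [|k| ^ 2] by at least
    [- O (t ^ 3)], by Parseval and the expansion of order three, and raises [eps * |z| ^ 2]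
    by [eps * t ^ 2]; the second gain wins for small [t]. The term in [eps] replaces any
    discussion of the first non-vanishing coefficient of [k]. *)
Lemma no_local_max (k : C -> C) (p : C) (eps : R) :
  smooth k p -> (0 < eps)%R ->
  ~ near0 (fun h => (Cmod (k (p + h)%C) ^ 2 + eps * Cmod (p + h) ^ 2
                     <= Cmod (k p) ^ 2 + eps * Cmod p ^ 2)%R).
Proof.
  intros Hk He [d0 [Hd0 Hmax]].
  destruct (Hk 3%nat) as [a0 [k1 [[a1 [k2 [[a2 [m [[M [HM Hm]] E2]]] E1]]] E0]]].
  destruct (near0_and Hm (near0_and E2 (near0_and E1 E0))) as [d [Hd H]].
  assert (Ha0 : k p = a0).
  { pose proof (near0_at E0) as E. simpl in E. rewrite Cplus_0_r in E. rewrite E. ring. }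
  rewrite Ha0 in Hmax.
  set (Lb := (Cmod a0 + Cmod a1 + Cmod a2)%R).
  assert (HLb : (0 <= Lb)%R).
  { unfold Lb. pose proof (Cmod_ge_0 a0). pose proof (Cmod_ge_0 a1).
    pose proof (Cmod_ge_0 a2). lra. }
  assert (HLM : (0 <= Lb * M)%R) by (apply Rmult_le_pos; lra).
  assert (Ht : exists t : R, (0 < t /\ t < d /\ t < d0 /\ t < 1 /\ t * (2 * Lb * M) < eps)%R).
  { assert (Hq : (0 < eps / (2 * Lb * M + 1))%R) by (apply Rdiv_lt_0_compat; lra).
    set (mn := Rmin (Rmin d d0) (Rmin 1 (eps / (2 * Lb * M + 1)))).
    assert (Hmn : (0 < mn)%R) by (repeat apply Rmin_glb_lt; lra).
    assert (B1 : (mn <= d)%R) by (eapply Rle_trans; [apply Rmin_l | apply Rmin_l]).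
    assert (B2 : (mn <= d0)%R) by (eapply Rle_trans; [apply Rmin_l | apply Rmin_r]).
    assert (B3 : (mn <= 1)%R) by (eapply Rle_trans; [apply Rmin_r | apply Rmin_l]).
    assert (B4 : (mn <= eps / (2 * Lb * M + 1))%R)
      by (eapply Rle_trans; [apply Rmin_r | apply Rmin_r]).
    exists (mn / 2)%R. repeat split; try lra.
    apply Rle_lt_trans with (eps / (2 * Lb * M + 1) / 2 * (2 * Lb * M + 1))%R.
    - apply Rmult_le_compat; lra.
    - replace (eps / (2 * Lb * M + 1) / 2 * (2 * Lb * M + 1))%R with (eps / 2)%R
        by (field; lra). lra. }
  destruct Ht as [t [Ht0 [Ht1 [Ht2 [Ht3 Ht4]]]]].
  pose proof (four_point_mean a0 a1 a2 t) as F1. cbv zeta in F1.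
  pose proof (four_point_mean p 1 0 t) as F2. cbv zeta in F2.
  assert (Hu : forall u, Cmod u = 1%R ->
    (Cmod (a0 + a1 * (t * u) + a2 * (t * u) ^ 2)%C ^ 2
     + eps * Cmod (p + 1 * (t * u) + 0 * (t * u) ^ 2)%C ^ 2
     <= Cmod a0 ^ 2 + eps * Cmod p ^ 2 + 2 * Lb * M * t ^ 3)%R).
  { intros u Hu1.
    assert (Hh : Cmod (t * u) = t).
    { rewrite Cmod_mult, Cmod_R, Hu1, Rabs_pos_eq by lra. ring. }
    set (h := t * u) in *.
    destruct (H h ltac:(lra)) as [Hmh [E2h [E1h E0h]]].
    specialize (Hmax h ltac:(lra)).
    replace (p + 1 * h + 0 * h ^ 2) with (p + h) by ring.
    set (L := a0 + a1 * h + a2 * h ^ 2).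
    assert (EL : L = k (p + h) + - (h ^ 3 * m h)).
    { rewrite E0h, E1h, E2h. unfold L. ring. }
    assert (HE : (Cmod (h ^ 3 * m h) <= M * t ^ 3)%R).
    { rewrite Cmod_mult, Cmod_pow, Hh, Rmult_comm.
      apply Rmult_le_compat_r; [apply pow_le; lra | exact Hmh]. }
    assert (HL : (Cmod L <= Lb)%R).
    { unfold L, Lb. eapply Rle_trans; [apply Cmod_triangle|].
      apply Rplus_le_compat; [eapply Rle_trans; [apply Cmod_triangle|]|].
      - rewrite Cmod_mult, Hh. pose proof (Cmod_ge_0 a1). nra.
      - rewrite Cmod_mult, Cmod_pow, Hh. pose proof (Cmod_ge_0 a2).
        assert (t ^ 2 <= 1)%R by (simpl; nra). nra. }
    pose proof (Cmod_triangle (k (p + h)) (- (h ^ 3 * m h))) as HT.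
    rewrite Cmod_opp, <- EL in HT.
    pose proof (Cmod_ge_0 L). pose proof (Cmod_ge_0 (k (p + h))).
    pose proof (Cmod_ge_0 (h ^ 3 * m h)).
    assert (Cmod L ^ 2 - 2 * Cmod L * Cmod (h ^ 3 * m h) <= Cmod (k (p + h)%C) ^ 2)%R.
    { set (x := Cmod L) in *. set (y := Cmod (k (p + h))) in *.
      set (e := Cmod (h ^ 3 * m h)) in *.
      destruct (Rle_lt_dec e x) as [Hex|Hex].
      - assert ((x - e) ^ 2 <= y ^ 2)%R by (apply pow_incr; lra).
        pose proof (pow2_ge_0 e). lra.
      - pose proof (pow2_ge_0 y).
        assert (x * x <= x * e)%R by (apply Rmult_le_compat_l; lra).
        assert (0 <= x * e)%R by (apply Rmult_le_pos; lra). lra. }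
    assert (Cmod L * Cmod (h ^ 3 * m h) <= Lb * (M * t ^ 3))%R
      by (apply Rmult_le_compat; auto).
    lra. }
  assert (U1 := Hu 1 Cmod_1). assert (U2 := Hu Ci Cmod_Ci).
  assert (U3 := Hu (- (1)) Cmod_m1).
  assert (U4 := Hu (- Ci) (eq_trans (Cmod_opp Ci) Cmod_Ci)).
  rewrite Cmod_1, Cmod_0 in F2.
  pose proof (Cmod_ge_0 a1). pose proof (Cmod_ge_0 a2).
  assert (0 <= t * t * (Cmod a1 * Cmod a1))%R by (repeat apply Rmult_le_pos; lra).
  assert (0 <= t * t * (t * t) * (Cmod a2 * Cmod a2))%R by (repeat apply Rmult_le_pos; lra).
  assert (t * t * (t * (2 * Lb * M)) < t * t * eps)%R.
  { apply Rmult_lt_compat_l; [now apply Rmult_lt_0_compat | exact Ht4]. }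
  nra.
Qed.

(** A maximum point of [|k| ^ 2 + eps * |z| ^ 2] on the closed disk cannot be interior, and
    [eps] is small enough to keep the value at a point where [|k| > B] above the values on
    the circle. *)
Lemma maximum_principle (k : C -> C) (R0 B : R) :
  (0 <= R0 < 1)%R -> (forall z, (Cmod z < 1)%R -> smooth k z) -> (0 <= B)%R ->
  (forall z, Cmod z = R0 -> (Cmod (k z) <= B)%R) ->
  forall z, (Cmod z <= R0)%R -> (Cmod (k z) <= B)%R.
Proof.
  intros HR Hk HB Hbd z1 Hz1. apply Rnot_lt_le. intros Hc.
  set (eps := ((Cmod (k z1) ^ 2 - B ^ 2) / 2)%R).
  assert (He : (0 < eps)%R) by (unfold eps; simpl; nra).
  set (F := fun z => (Cmod (k z) ^ 2 + eps * Cmod z ^ 2)%R).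
  destruct (@max_on_disk F R0) as [p [Hp Hmax]].
  - lra.
  - intros p e Hp Hep.
    set (A := (2 * Cmod (k p) + 1)%R). set (D := (eps * (2 * Cmod p + 1))%R).
    pose proof (Cmod_ge_0 p) as Gp. pose proof (Cmod_ge_0 (k p)) as Gk.
    assert (HA : (0 < A)%R) by (unfold A; lra).
    assert (HD : (0 < D)%R) by (unfold D; apply Rmult_lt_0_compat; lra).
    destruct (@smooth_close k p (Rmin 1 (e / (2 * A))) (Hk p ltac:(lra))) as [d [Hd H]].
    { apply Rmin_glb_lt; [lra | apply Rdiv_lt_0_compat; lra]. }
    exists (Rmin d (Rmin 1 (e / (2 * D)))). split.
    { repeat apply Rmin_glb_lt; try lra. apply Rdiv_lt_0_compat; lra. }
    intros z Hz.
    assert (Q1 : (Cmod (z - p) < d)%R) by (eapply Rlt_le_trans; [exact Hz | apply Rmin_l]).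
    assert (Q2 : (Cmod (z - p) < Rmin 1 (e / (2 * D)))%R)
      by (eapply Rlt_le_trans; [exact Hz | apply Rmin_r]).
    pose proof (Rmin_l 1 (e / (2 * D))) as Q3. pose proof (Rmin_r 1 (e / (2 * D))) as Q4.
    specialize (H _ Q1). replace (p + (z - p)) with z in H by ring.
    pose proof (Rmin_l 1 (e / (2 * A))) as Q5. pose proof (Rmin_r 1 (e / (2 * A))) as Q6.
    pose proof (Cmod_sqr_close (k z) (k p)) as S1.
    pose proof (Cmod_sqr_close z p) as S2.
    pose proof (Cmod_ge_0 (z - p)) as G1. pose proof (Cmod_ge_0 (k z - k p)) as G2.
    assert (T1 : (Cmod (k z - k p) * (2 * Cmod (k p) + Cmod (k z - k p)) < e / 2)%R).
    { apply Rle_lt_trans with (Cmod (k z - k p) * A)%R.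
      - apply Rmult_le_compat_l; [exact G2 | unfold A; lra].
      - replace (e / 2)%R with (e / (2 * A) * A)%R by (field; lra).
        apply Rmult_lt_compat_r; lra. }
    assert (T2 : (eps * (Cmod (z - p) * (2 * Cmod p + Cmod (z - p))) < e / 2)%R).
    { apply Rle_lt_trans with (Cmod (z - p) * D)%R.
      - unfold D.
        replace (Cmod (z - p) * (eps * (2 * Cmod p + 1)))%R
          with (eps * (Cmod (z - p) * (2 * Cmod p + 1)))%R by ring.
        apply Rmult_le_compat_l; [lra|]. apply Rmult_le_compat_l; lra.
      - replace (e / 2)%R with (e / (2 * D) * D)%R by (field; lra).
        apply Rmult_lt_compat_r; lra. }
    unfold F.
    replace (Cmod (k z) ^ 2 + eps * Cmod z ^ 2 - (Cmod (k p) ^ 2 + eps * Cmod p ^ 2))%R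
      with ((Cmod (k z) ^ 2 - Cmod (k p) ^ 2) + eps * (Cmod z ^ 2 - Cmod p ^ 2))%R by ring.
    eapply Rle_lt_trans; [apply Rabs_triang|].
    rewrite Rabs_mult, (Rabs_pos_eq eps) by lra.
    assert (eps * Rabs (Cmod z ^ 2 - Cmod p ^ 2)
            <= eps * (Cmod (z - p) * (2 * Cmod p + Cmod (z - p))))%R
      by (apply Rmult_le_compat_l; lra).
    lra.
  - destruct (Rle_lt_or_eq_dec _ _ Hp) as [Hlt|Heq].
    + apply (@no_local_max k p eps (Hk p ltac:(lra)) He).
      exists (R0 - Cmod p)%R. split; [lra|]. intros h Hh.
      apply Hmax. eapply Rle_trans; [apply Cmod_triangle|]. lra.
    + pose proof (Hmax z1 Hz1) as H1. unfold F in H1.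
      pose proof (Hbd p Heq) as H2. rewrite Heq in H1.
      pose proof (Cmod_ge_0 (k p)). pose proof (Cmod_ge_0 z1).
      assert (Cmod (k p) ^ 2 <= B ^ 2)%R by (apply pow_incr; lra).
      assert (0 <= eps * Cmod z1 ^ 2)%R by (apply Rmult_le_pos; [lra | apply pow2_ge_0]).
      assert (eps * R0 ^ 2 <= eps * 1)%R by (apply Rmult_le_compat_l; simpl; nra).
      unfold eps in *. lra.
Qed.

(** * Moebius transformations *)

Lemma unit_disk_iff (z : C) : unit_disk z <-> (Cmod z < 1)%R.
Proof.
  unfold unit_disk, open_disk. now replace (z - 0) with z by ring.
Qed.

Lemma one_plus_ne0 (x : C) : (Cmod x < 1)%R -> 1 + x <> 0.
Proof.
  intros H Hc. assert (E : x = - (1)) by (replace x with (1 + x - 1) by ring; rewrite Hc; ring).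
  rewrite E, Cmod_m1 in H. lra.
Qed.

Lemma Cmod_conj_mul_lt1 (a z : C) :
  (Cmod a < 1)%R -> (Cmod z <= 1)%R -> (Cmod (Cconj a * z) < 1)%R.
Proof.
  intros Ha Hz. rewrite Cmod_mult, Cmod_conj.
  pose proof (Cmod_ge_0 a). pose proof (Cmod_ge_0 z). nra.
Qed.

Lemma T_den_ne0 (a z : C) :
  (Cmod a < 1)%R -> (Cmod z <= 1)%R -> 1 + Cconj a * z <> 0.
Proof. intros Ha Hz. now apply one_plus_ne0, Cmod_conj_mul_lt1. Qed.

Lemma Cmod_sqr_T_num (a z : C) :
  (Cmod (z + a) ^ 2
   = Cmod (1 + Cconj a * z) ^ 2 - (1 - Cmod a ^ 2) * (1 - Cmod z ^ 2))%R.
Proof.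
  rewrite !Cmod2_alt. destruct a as [x y], z as [u v]. unfold Re, Im. simpl. ring.
Qed.

Lemma Cmod_T (a z : C) :
  (Cmod a < 1)%R -> (Cmod z <= 1)%R ->
  Cmod (T a z) = (Cmod (z + a) / Cmod (1 + Cconj a * z))%R.
Proof. intros Ha Hz. unfold T. apply Cmod_div. now apply T_den_ne0. Qed.

Lemma Cmod_T_le1 (a z : C) :
  (Cmod a < 1)%R -> (Cmod z <= 1)%R -> (Cmod (T a z) <= 1)%R.
Proof.
  intros Ha Hz. rewrite Cmod_T by assumption.
  pose proof (proj1 (Cmod_gt_0 _) (T_den_ne0 Ha Hz)) as Hp.
  pose proof (Cmod_sqr_T_num a z) as E.
  pose proof (Cmod_ge_0 a). pose proof (Cmod_ge_0 z). pose proof (Cmod_ge_0 (z + a)).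
  assert (0 <= (1 - Cmod a ^ 2) * (1 - Cmod z ^ 2))%R
    by (apply Rmult_le_pos; simpl; nra).
  apply Rmult_le_reg_r with (1 := Hp). unfold Rdiv.
  rewrite Rmult_assoc, Rinv_l by lra. nra.
Qed.

Lemma Cmod_T_lt1 (a z : C) :
  (Cmod a < 1)%R -> (Cmod z < 1)%R -> (Cmod (T a z) < 1)%R.
Proof.
  intros Ha Hz. rewrite Cmod_T by lra.
  pose proof (proj1 (Cmod_gt_0 _) (T_den_ne0 Ha (Rlt_le _ _ Hz))) as Hp.
  pose proof (Cmod_sqr_T_num a z) as E.
  pose proof (Cmod_ge_0 a). pose proof (Cmod_ge_0 z). pose proof (Cmod_ge_0 (z + a)).
  assert (0 < (1 - Cmod a ^ 2) * (1 - Cmod z ^ 2))%R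
    by (apply Rmult_lt_0_compat; simpl; nra).
  apply Rmult_lt_reg_r with (1 := Hp). unfold Rdiv.
  rewrite Rmult_assoc, Rinv_l by lra. nra.
Qed.

Lemma conj_mul_self (a : C) : a * Cconj a = RtoC (Cmod a ^ 2).
Proof. symmetry. apply Cmod2_conj. Qed.

Lemma one_sub_conj_ne0 (a : C) : (Cmod a < 1)%R -> 1 - a * Cconj a <> 0.
Proof.
  intros H. pose proof (@T_den_ne0 a (- a) H) as H1.
  rewrite Cmod_opp in H1. specialize (H1 ltac:(lra)).
  intros Hc. apply H1. rewrite <- Hc. ring.
Qed.

Lemma T_inv (a z : C) :
  (Cmod a < 1)%R -> (Cmod z <= 1)%R -> T a (T (- a) z) = z.
Proof.
  intros Ha Hz. unfold T. rewrite Copp_conj.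
  pose proof (one_sub_conj_ne0 Ha) as H1.
  pose proof (@T_den_ne0 (- a) z ltac:(now rewrite Cmod_opp) Hz) as H2.
  rewrite Copp_conj in H2.
  field. split; [exact H2|].
  replace (1 + - Cconj a * z + Cconj a * (z + - a)) with (1 - a * Cconj a) by ring.
  exact H1.
Qed.

Lemma T_self (p : C) : T (- p) p = 0.
Proof. unfold T, Cdiv. replace (p + - p) with (RtoC 0) by ring. ring. Qed.

Lemma smooth_T (w : C -> C) (a q : C) :
  smooth w q -> 1 + Cconj a * w q <> 0 -> smooth (fun z => T a (w z)) q.
Proof.
  intros Hw Hne. unfold T, Cdiv.
  apply smooth_mul.
  - apply smooth_add; [exact Hw | apply smooth_const].
  - apply smooth_inv; [|exact Hne].
    apply smooth_add; [apply smooth_const|].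
    apply smooth_mul; [apply smooth_const | exact Hw].
Qed.

(** * The Schur algorithm *)

(** The values are allowed on the unit circle, so that the constants produced when the
    algorithm stops belong to the class. *)
Definition schur (k : C -> C) : Prop :=
  forall z : C, (Cmod z < 1)%R -> smooth k z /\ (Cmod (k z) <= 1)%R.

Lemma schur_T (k : C -> C) (a : C) :
  (Cmod a < 1)%R -> schur k -> schur (fun z => T a (k z)).
Proof.
  intros Ha Hk z Hz. destruct (Hk z Hz) as [H1 H2]. split.
  - apply smooth_T; [exact H1 | now apply T_den_ne0].
  - now apply Cmod_T_le1.
Qed.

Lemma jet1_unique (f g : C -> C) :
  jet 1 f -> jet 1 g -> near0 (fun h => h <> 0 -> f h = g h) -> f 0 = g 0.
Proof.
  intros Hf Hg E. apply Cmod_sub_le0. apply Rnot_lt_le. intros Hc.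
  set (e := Cmod (f 0 - g 0)) in *.
  destruct (near0_and E (near0_and (jet1_close Hf (eps := e / 2) ltac:(lra))
              (jet1_close Hg (eps := e / 2) ltac:(lra)))) as [d [Hd H]].
  set (h := RtoC (d / 2)).
  assert (Hh : Cmod h = (d / 2)%R) by (unfold h; rewrite Cmod_R; apply Rabs_pos_eq; lra).
  assert (Hn : h <> 0) by (apply Cmod_gt_0; lra).
  destruct (H h ltac:(lra)) as [H1 [H2 H3]]. rewrite (H1 Hn) in H2.
  pose proof (Cmod_triangle (- (g h - f 0)) (g h - g 0)) as Ht.
  rewrite Cmod_opp in Ht.
  replace (- (g h - f 0) + (g h - g 0)) with (f 0 - g 0) in Ht by ring.
  fold e in Ht. lra.
Qed.

(** Each order of expansion provides its own quotient, and these may differ at [0] only; their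
    value there is the limit of the quotients, hence the same number [c] for all orders. *)
Lemma smooth_zero_factor (h : C -> C) (p : C) :
  smooth h p -> h p = 0 ->
  exists c : C, forall n : nat, exists g : C -> C,
    jet n g /\ g 0 = c /\ near0 (fun x => h (p + x) = x * g x).
Proof.
  intros Hh H0.
  assert (Hf : forall n, exists g, jet n g /\ near0 (fun x => h (p + x) = x * g x)).
  { intros n. destruct (Hh (S n)) as [a [g [J E]]]. exists g. split; [exact J|].
    assert (Ha : a = 0).
    { pose proof (near0_at E) as E0. cbv beta in E0. rewrite Cplus_0_r, H0 in E0.
      rewrite E0. ring. }
    apply near0_mono with (2 := E). intros x Hx. rewrite Hx, Ha. ring. }
  destruct (Hf 1%nat) as [g [Jg Eg]]. exists (g 0). intros n.
  destruct (Hf (S n)) as [g' [Jg' Eg']]. exists g'. split; [now apply jet_S|].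
  split; [|exact Eg']. apply jet1_unique; [|exact Jg|].
  - clear - Jg'. induction n as [|n IH]; [exact Jg'|]. apply IH. now apply jet_S.
  - apply near0_mono with (2 := near0_and Eg Eg'). intros x [H1 H2] Hx.
    rewrite H1 in H2. apply (f_equal (fun y => / x * y)) in H2.
    rewrite !Cmult_assoc, !Cinv_l, !Cmult_1_l in H2 by exact Hx. now symmetry.
Qed.

(** Quantitative form of [|T (- p) w| -> 1] as [|w| -> 1]. *)
Lemma Cmod_T_near_circle (p w : C) :
  (Cmod p < 1)%R -> (Cmod w <= 1)%R ->
  (1 - (1 + Cmod p) / (1 - Cmod p) * (1 - Cmod w ^ 2) <= Cmod (T (- p) w) ^ 2)%R.
Proof.
  intros Hp Hw.
  assert (Hp' : (Cmod (- p) < 1)%R) by now rewrite Cmod_opp.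
  rewrite Cmod_T by assumption.
  pose proof (proj1 (Cmod_gt_0 _) (T_den_ne0 Hp' Hw)) as Hd.
  pose proof (Cmod_sqr_T_num (- p) w) as E. rewrite Cmod_opp in E.
  set (d := Cmod (1 + Cconj (- p) * w)) in *.
  assert (Hdp : (1 - Cmod p <= d)%R).
  { pose proof (Cmod_triangle (1 + Cconj (- p) * w) (- (Cconj (- p) * w))) as Ht.
    replace (1 + Cconj (- p) * w + - (Cconj (- p) * w)) with (RtoC 1) in Ht by ring.
    rewrite Cmod_1, Cmod_opp, Cmod_mult, Cmod_conj, Cmod_opp in Ht. fold d in Ht.
    pose proof (Cmod_ge_0 p). pose proof (Cmod_ge_0 w). nra. }
  unfold Rdiv at 2. rewrite Rpow_mult_distr, E.
  pose proof (Cmod_ge_0 p) as G1. pose proof (Cmod_ge_0 w) as G2.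
  assert (Hw2 : (0 <= 1 - Cmod w ^ 2)%R) by (simpl; nra).
  assert (Hi : ((/ d) ^ 2 <= (/ (1 - Cmod p)) ^ 2)%R).
  { apply pow_incr. split; [left; now apply Rinv_0_lt_compat|].
    apply Rinv_le_contravar; lra. }
  replace ((d ^ 2 - (1 - Cmod p ^ 2) * (1 - Cmod w ^ 2)) * (/ d) ^ 2)%R
    with (1 - (1 - Cmod p ^ 2) * (1 - Cmod w ^ 2) * (/ d) ^ 2)%R by (field; lra).
  replace ((1 + Cmod p) / (1 - Cmod p) * (1 - Cmod w ^ 2))%R
    with ((1 - Cmod p ^ 2) * (1 - Cmod w ^ 2) * (/ (1 - Cmod p)) ^ 2)%R by (field; lra).
  assert (0 <= (1 - Cmod p ^ 2) * (1 - Cmod w ^ 2))%R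
    by (apply Rmult_le_pos; [simpl; nra | exact Hw2]).
  apply Rplus_le_compat_l, Ropp_le_contravar. now apply Rmult_le_compat_l.
Qed.

(** The quotient is smooth, the zero at [p] being removable. Near the unit circle its
    modulus is at most [/ |T (- p) w|], which tends to [1], and the maximum principle
    carries this bound inside. *)
Lemma schwarz_division (h : C -> C) (p : C) :
  schur h -> (Cmod p < 1)%R -> h p = 0 ->
  exists k : C -> C, schur k /\
    forall z, (Cmod z < 1)%R -> h z = T (- p) z * k z.
Proof.
  intros Hh Hp H0.
  assert (Hp' : (Cmod (- p) < 1)%R) by now rewrite Cmod_opp.
  destruct (smooth_zero_factor (proj1 (Hh p Hp)) H0) as [c Hc].
  set (k := fun z => if Ceq_dec z p then c * (1 - p * Cconj p) else h z / T (- p) z).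
  assert (HTne : forall z, (Cmod z < 1)%R -> z <> p -> T (- p) z <> 0).
  { intros z Hz Hne HT. apply Hne.
    rewrite <- (@T_inv p z Hp (Rlt_le _ _ Hz)), HT. unfold T, Cdiv.
    replace (1 + Cconj p * 0) with (RtoC 1) by ring. field. }
  assert (Hfac : forall z, (Cmod z < 1)%R -> h z = T (- p) z * k z).
  { intros z Hz. unfold k. destruct (Ceq_dec z p) as [->|Hne].
    - rewrite T_self, H0. ring.
    - field. now apply HTne. }
  assert (Hsm : forall z, (Cmod z < 1)%R -> smooth k z).
  { intros q Hq. destruct (Ceq_dec q p) as [->|Hne].
    - intros n. destruct (Hc n) as [g [Jg [Eg0 Eg]]].
      apply jet_ext with (fun x => g x * (1 + Cconj (- p) * (p + x))).
      + apply near0_mono with (2 := near0_and Eg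
          (near0_lt (d := 1 - Cmod p) ltac:(lra))).
        intros x [Ex Hx]. unfold k. destruct (Ceq_dec (p + x) p) as [Hxp|Hxp].
        * assert (x = 0) as -> by (replace x with (p + x - p) by ring; rewrite Hxp; ring).
          rewrite Eg0, Copp_conj. ring.
        * assert (Hpx : (Cmod (p + x) < 1)%R)
            by (eapply Rle_lt_trans; [apply Cmod_triangle | lra]).
          pose proof (@T_den_ne0 (- p) (p + x) Hp' (Rlt_le _ _ Hpx)) as Hden.
          assert (Hx0 : x <> 0) by (intros ->; apply Hxp; ring).
          rewrite Ex. unfold T.
          replace (p + x + - p) with x by ring. field. now split.
      + apply jet_mul; [exact Jg|].
        apply jet_add; [apply jet_const|]. apply jet_mul; [apply jet_const|].
        apply jet_add; [apply jet_const | apply jet_id].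
    - apply smooth_ext with (fun z => h z * / T (- p) z).
      + assert (Hd : (0 < Cmod (p - q))%R).
        { apply Cmod_gt_0. intros Hz. apply Hne.
          replace q with (p - (p - q)) by ring. rewrite Hz. ring. }
        exists (Cmod (p - q)). split; [exact Hd|]. intros x Hx.
        unfold k. destruct (Ceq_dec (q + x) p) as [E|_]; [|reflexivity].
        exfalso. rewrite <- E in Hx. replace (q + x - q) with x in Hx by ring. lra.
      + apply smooth_mul; [apply Hh; exact Hq|].
        apply smooth_inv; [|now apply HTne].
        apply (smooth_T (w := fun z => z)); [apply smooth_id|].
        apply T_den_ne0; [exact Hp' | lra]. }
  exists k. split; [|exact Hfac].
  intros z Hz. split; [now apply Hsm|]. apply Rnot_lt_le. intros Hbig.
  set (B := ((1 + Cmod (k z)) / 2)%R).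
  assert (HB : (1 < B < Cmod (k z))%R) by (unfold B; lra).
  set (C0 := ((1 + Cmod p) / (1 - Cmod p))%R).
  pose proof (Cmod_ge_0 p) as Gp. pose proof (Cmod_ge_0 z) as Gz.
  assert (HC0 : (0 < C0)%R) by (unfold C0; apply Rdiv_lt_0_compat; lra).
  assert (HB2 : (1 < B ^ 2)%R) by (simpl; nra).
  set (e := (1 - / B ^ 2)%R).
  assert (He : (0 < e)%R).
  { unfold e. rewrite <- Rinv_1 at 1. apply Rlt_0_minus, Rinv_lt_contravar; lra. }
  (* on the circle of radius [R0] the bound of [Cmod_T_near_circle] gives
     [|T (- p) w| ^ 2 >= / B ^ 2] *)
  set (R0 := Rmax (Cmod z) (1 - e / (2 * C0))).
  assert (He2 : (0 < e / (2 * C0))%R) by (apply Rdiv_lt_0_compat; lra).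
  assert (HR1 : (R0 < 1)%R) by (apply Rmax_lub_lt; lra).
  assert (HR2 : (Cmod z <= R0)%R) by apply Rmax_l.
  assert (HR3 : (1 - R0 <= e / (2 * C0))%R).
  { assert (1 - e / (2 * C0) <= R0)%R by apply Rmax_r. lra. }
  assert (Hle : (Cmod (k z) <= B)%R); [|lra].
  apply maximum_principle with R0; try assumption; try lra.
  intros w Hw. apply Rnot_lt_le. intros Hkw.
  assert (Hw1 : (Cmod w < 1)%R) by lra.
  pose proof (@Cmod_T_near_circle p w Hp (Rlt_le _ _ Hw1)) as HT. fold C0 in HT.
  assert (Hth : (/ B ^ 2 <= Cmod (T (- p) w) ^ 2)%R).
  { eapply Rle_trans; [|exact HT]. rewrite Hw.
    assert (H1 : (1 - R0 ^ 2 <= 2 * (e / (2 * C0)))%R) by (simpl; nra).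
    assert (H2 : (C0 * (1 - R0 ^ 2) <= C0 * (2 * (e / (2 * C0))))%R)
      by (apply Rmult_le_compat_l; lra).
    replace (C0 * (2 * (e / (2 * C0))))%R with e in H2 by (field; lra).
    unfold e in H2. lra. }
  pose proof (proj2 (Hh w Hw1)) as Hhw. rewrite (Hfac w Hw1), Cmod_mult in Hhw.
  assert (H3 : (1 < (Cmod (T (- p) w) * Cmod (k w)) ^ 2)%R).
  { rewrite Rpow_mult_distr.
    apply Rle_lt_trans with (/ B ^ 2 * B ^ 2)%R; [right; field; lra|].
    apply Rle_lt_trans with (Cmod (T (- p) w) ^ 2 * B ^ 2)%R.
    - apply Rmult_le_compat_r; lra.
    - apply Rmult_lt_compat_l.
      + eapply Rlt_le_trans; [|exact Hth]. apply Rinv_0_lt_compat. lra.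
      + simpl. nra. }
  assert (H4 : (0 <= Cmod (T (- p) w) * Cmod (k w))%R)
    by (apply Rmult_le_pos; apply Cmod_ge_0).
  simpl in H3. nra.
Qed.

Lemma schur_step (k : C -> C) (p : C) :
  schur k -> (Cmod p < 1)%R -> (Cmod (k p) < 1)%R ->
  exists k1 : C -> C, schur k1 /\
    forall z, (Cmod z < 1)%R -> k z = T (k p) (T (- p) z * k1 z).
Proof.
  intros Hk Hp Hkp.
  destruct (@schwarz_division (fun z => T (- k p) (k z)) p) as [k1 [Hk1 E]].
  - apply schur_T; [now rewrite Cmod_opp | exact Hk].
  - exact Hp.
  - apply T_self.
  - exists k1. split; [exact Hk1|]. intros z Hz. rewrite <- (E z Hz).
    symmetry. apply T_inv; [exact Hkp | apply Hk; exact Hz].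
Qed.

Lemma schwarz_pick (k : C -> C) (p q : C) :
  schur k -> (Cmod p < 1)%R -> (Cmod q < 1)%R -> (Cmod (k p) < 1)%R ->
  (Cmod (k q - k p) <= Cmod (T (- p) q) * Cmod (1 - Cconj (k p) * k q))%R.
Proof.
  intros Hk Hp Hq Hkp.
  destruct (schur_step Hk Hp Hkp) as [k1 [Hk1 E]].
  pose proof (proj2 (Hk1 q Hq)) as H1.
  assert (HTq : (Cmod (T (- p) q) < 1)%R) by (apply Cmod_T_lt1; [now rewrite Cmod_opp | exact Hq]).
  set (x := T (- p) q * k1 q).
  assert (Hx : (Cmod x <= Cmod (T (- p) q))%R).
  { unfold x. rewrite Cmod_mult. pose proof (Cmod_ge_0 (T (- p) q)). nra. }
  assert (Eq : k q - k p = x * (1 - Cconj (k p) * k q)).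
  { rewrite (E q Hq). fold x. unfold T. field. apply T_den_ne0; [exact Hkp | lra]. }
  rewrite Eq, Cmod_mult. apply Rmult_le_compat_r; [apply Cmod_ge_0 | exact Hx].
Qed.

(** The strong maximum principle, without an identity theorem: Schwarz-Pick applies to
    [t * k] for [t < 1], and for [t -> 1] it becomes [|k q - k p| <= delta * |k q - k p|]
    with [delta < 1], because [|k p| = 1]. *)
Lemma schur_unimodular_const (k : C -> C) (p : C) :
  schur k -> (Cmod p < 1)%R -> Cmod (k p) = 1%R ->
  forall q, (Cmod q < 1)%R -> k q = k p.
Proof.
  intros Hk Hp Hkp q Hq. apply Cmod_sub_le0. apply Rnot_lt_le. intros HD.
  set (D := Cmod (k q - k p)) in *. set (dl := Cmod (T (- p) q)).
  assert (Hdl : (dl < 1)%R) by (apply Cmod_T_lt1; [now rewrite Cmod_opp | exact Hq]).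
  assert (Hdl0 : (0 <= dl)%R) by apply Cmod_ge_0.
  assert (Hone : k p * Cconj (k p) = 1).
  { rewrite conj_mul_self, Hkp. f_equal. ring. }
  assert (Ht : forall t : R, (0 < t < 1)%R -> (t * D <= dl * (D + (1 - t ^ 2)))%R).
  { intros t Ht.
    assert (Hk' : schur (fun z => t * k z)).
    { intros z Hz. destruct (Hk z Hz) as [H1 H2]. split.
      - apply smooth_mul; [apply smooth_const | exact H1].
      - rewrite Cmod_mult, Cmod_R, Rabs_pos_eq by lra. pose proof (Cmod_ge_0 (k z)). nra. }
    pose proof (@schwarz_pick _ p q Hk' Hp Hq) as H. cbv beta in H.
    rewrite Cmod_mult, Cmod_R, Rabs_pos_eq, Hkp in H by lra.
    specialize (H ltac:(lra)). fold dl in H.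
    replace (t * k q - t * k p) with (t * (k q - k p)) in H by ring.
    rewrite Cmod_mult, Cmod_R, Rabs_pos_eq in H by lra. fold D in H.
    eapply Rle_trans; [exact H|]. apply Rmult_le_compat_l; [exact Hdl0|].
    assert (Hct : Cconj t = t) by (unfold Cconj, RtoC; simpl; f_equal; ring).
    rewrite Cmult_conj, Hct.
    replace (1 - t * Cconj (k p) * (t * k q))
      with (- Cconj (k p) * (k q - k p) + RtoC (1 - t ^ 2) * (Cconj (k p) * k q)).
    2:{ rewrite RtoC_minus, RtoC_pow.
        transitivity (k p * Cconj (k p) - t * t * (Cconj (k p) * k q)); [|rewrite Hone]; ring. }
    eapply Rle_trans; [apply Cmod_triangle|].
    rewrite !Cmod_mult, Cmod_opp, Cmod_conj, Hkp, Cmod_R. fold D.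
    rewrite Rabs_pos_eq by (simpl; nra).
    pose proof (proj2 (Hk q Hq)). assert (0 <= 1 - t ^ 2)%R by (simpl; nra). nra. }
  (* with [t = 1 - s] the inequality gives [(1 - dl) * D <= s * (D + 2)], which fails
     for this [s] *)
  set (s := Rmin (/ 2) (D * (1 - dl) / (2 * (D + 2)))).
  assert (Hs0 : (0 < s)%R).
  { apply Rmin_glb_lt; [lra|]. apply Rdiv_lt_0_compat; [|lra].
    apply Rmult_lt_0_compat; lra. }
  assert (Hs1 : (s <= / 2)%R) by apply Rmin_l.
  assert (Hs2 : (s * (2 * (D + 2)) <= D * (1 - dl))%R).
  { apply Rmult_le_reg_r with (/ (2 * (D + 2)))%R; [apply Rinv_0_lt_compat; lra|].
    rewrite Rmult_assoc, Rinv_r, Rmult_1_r by lra. apply Rmin_r. }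
  pose proof (Ht (1 - s)%R ltac:(lra)) as H.
  assert (dl * (1 - (1 - s) ^ 2) <= 1 * (2 * s))%R
    by (apply Rmult_le_compat; simpl; nra).
  nra.
Qed.

(** * Rational functions are analytic off their poles *)

Fixpoint peval (l : list C) (x : C) : C :=
  match l with
  | nil => 0
  | a :: l' => a + x * peval l' x
  end.

Fixpoint l1norm (l : list C) : R :=
  match l with
  | nil => 0%R
  | a :: l' => (Cmod a + l1norm l')%R
  end.

Fixpoint padd (l m : list C) : list C :=
  match l, m with
  | nil, _ => m
  | _, nil => l
  | a :: l', b :: m' => (a + b) :: padd l' m'
  end.

Definition pscale (c : C) (l : list C) : list C := map (Cmult c) l.

Lemma l1norm_ge0 (l : list C) : (0 <= l1norm l)%R.
Proof.
  induction l as [|a l IH]; simpl; [lra|]. pose proof (Cmod_ge_0 a). lra.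
Qed.

Lemma peval_padd (l m : list C) (x : C) : peval (padd l m) x = peval l x + peval m x.
Proof.
  revert m. induction l as [|a l IH]; intros [|b m]; simpl; try ring.
  rewrite IH. ring.
Qed.

Lemma peval_pscale (c : C) (l : list C) (x : C) : peval (pscale c l) x = c * peval l x.
Proof.
  induction l as [|a l IH]; simpl; [ring|].
  change (map (Cmult c) l) with (pscale c l). rewrite IH. ring.
Qed.

Lemma l1norm_padd (l m : list C) : (l1norm (padd l m) <= l1norm l + l1norm m)%R.
Proof.
  revert m. induction l as [|a l IH]; intros [|b m]; simpl; try lra.
  specialize (IH m). pose proof (Cmod_triangle a b). lra.
Qed.

Lemma l1norm_pscale (c : C) (l : list C) : (l1norm (pscale c l) = Cmod c * l1norm l)%R.
Proof.
  induction l as [|a l IH]; simpl; [ring|].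
  change (map (Cmult c) l) with (pscale c l). rewrite IH, Cmod_mult. ring.
Qed.

Lemma peval_le_l1norm (l : list C) (x : C) :
  (Cmod x <= 1)%R -> (Cmod (peval l x) <= l1norm l)%R.
Proof.
  intros Hx. induction l as [|a l IH]; simpl; [rewrite Cmod_0; lra|].
  eapply Rle_trans; [apply Cmod_triangle|]. rewrite Cmod_mult.
  pose proof (Cmod_ge_0 x). pose proof (Cmod_ge_0 (peval l x)). nra.
Qed.

(** Long division in increasing powers: [P = c * (b + x * Q) + x * division_step b Q P],
    where [c * b] is the constant term of [P]. The divisor [b + x * Q] is the list
    [b :: Q]. *)
Definition division_step (b : C) (Q P : list C) : list C :=
  padd (tl P) (pscale (- (hd (RtoC 0) P / b)) Q).

Definition division_remainder (b : C) (Q P : list C) (n : nat) : list C :=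
  Nat.iter n (division_step b Q) P.

Definition division_coef (b : C) (Q P : list C) (n : nat) : C :=
  hd (RtoC 0) (division_remainder b Q P n) / b.

Lemma division_step_spec (b : C) (Q P : list C) (x : C) :
  b <> 0 ->
  peval P x = hd (RtoC 0) P / b * peval (b :: Q) x + x * peval (division_step b Q P) x.
Proof.
  intros Hb. unfold division_step. rewrite peval_padd, peval_pscale.
  destruct P as [|a P]; simpl; field; exact Hb.
Qed.

Lemma division_remainder_spec (b : C) (Q P : list C) (x : C) (n : nat) :
  b <> 0 ->
  peval P x = psum (division_coef b Q P) x n * peval (b :: Q) x
              + x ^ n * peval (division_remainder b Q P n) x.
Proof.
  intros Hb. induction n as [|n IH]; [simpl; ring|].
  rewrite IH, (division_step_spec Q (division_remainder b Q P n) x Hb).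
  change (division_remainder b Q P (S n)) with (division_step b Q (division_remainder b Q P n)).
  change (psum (division_coef b Q P) x (S n))
    with (psum (division_coef b Q P) x n + division_coef b Q P n * x ^ n).
  unfold division_coef. rewrite Cpow_S. ring.
Qed.

Lemma l1norm_division_remainder (b : C) (Q P : list C) (n : nat) :
  b <> 0 ->
  (l1norm (division_remainder b Q P n) <= l1norm P * (1 + l1norm Q / Cmod b) ^ n)%R.
Proof.
  intros Hb. pose proof (proj1 (Cmod_gt_0 _) Hb) as Hbp. pose proof (l1norm_ge0 Q) as HQ.
  assert (HK : (0 <= l1norm Q / Cmod b)%R)
    by (apply Rmult_le_pos; [exact HQ | left; now apply Rinv_0_lt_compat]).
  induction n as [|n IH]; [simpl; lra|].
  change (division_remainder b Q P (S n)) with (division_step b Q (division_remainder b Q P n)).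
  apply Rle_trans with (l1norm (division_remainder b Q P n) * (1 + l1norm Q / Cmod b))%R.
  - unfold division_step. eapply Rle_trans; [apply l1norm_padd|].
    rewrite l1norm_pscale, Cmod_opp, Cmod_div by exact Hb.
    assert (H : (l1norm (tl (division_remainder b Q P n)) + Cmod (hd (RtoC 0) (division_remainder b Q P n))
                 = l1norm (division_remainder b Q P n))%R).
    { destruct (division_remainder b Q P n); simpl; [rewrite Cmod_0|]; ring. }
    pose proof (l1norm_ge0 (tl (division_remainder b Q P n))) as H0.
    replace (Cmod (hd (RtoC 0) (division_remainder b Q P n)) / Cmod b * l1norm Q)%R
      with (Cmod (hd (RtoC 0) (division_remainder b Q P n)) * (l1norm Q / Cmod b))%R
      by (field; lra).
    pose proof (Cmod_ge_0 (hd (RtoC 0) (division_remainder b Q P n))).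
    rewrite <- H. nra.
  - simpl pow. rewrite (Rmult_comm (1 + _)), <- Rmult_assoc.
    apply Rmult_le_compat_r; lra.
Qed.

(** The remainders grow at most geometrically in the [l1] norm of their coefficients, so
    that [x ^ n] times the [n]-th remainder tends to zero for small [x]. *)
Lemma quotient_has_pseries (b : C) (Q P : list C) :
  b <> 0 ->
  exists delta : R,
    has_pseries (division_coef b Q P) delta (fun x => peval P x / peval (b :: Q) x).
Proof.
  intros Hb. pose proof (proj1 (Cmod_gt_0 _) Hb) as Hbp. pose proof (l1norm_ge0 Q) as HQ.
  set (K := (1 + l1norm Q / Cmod b)%R).
  assert (HK : (1 <= K)%R).
  { assert (0 <= l1norm Q / Cmod b)%R
      by (apply Rmult_le_pos; [exact HQ | left; now apply Rinv_0_lt_compat]).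
    unfold K. lra. }
  exists (/ (2 * K))%R. split; [apply Rinv_0_lt_compat; lra|].
  intros x Hx.
  assert (HxK : (Cmod x * K < / 2)%R).
  { replace (/ 2)%R with (/ (2 * K) * K)%R by (field; lra).
    apply Rmult_lt_compat_r; lra. }
  pose proof (Cmod_ge_0 x) as Gx.
  assert (Hx1 : (Cmod x <= 1)%R) by nra.
  assert (HQx : (Cmod b / 2 <= Cmod (peval (b :: Q) x))%R).
  { simpl. pose proof (Cmod_triangle (b + x * peval Q x) (- (x * peval Q x))) as Ht.
    replace (b + x * peval Q x + - (x * peval Q x)) with b in Ht by ring.
    rewrite Cmod_opp, Cmod_mult in Ht.
    pose proof (peval_le_l1norm Q Hx1) as H1.
    assert (H2 : (Cmod x * l1norm Q <= Cmod b * (Cmod x * K))%R).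
    { unfold K. replace (Cmod b * (Cmod x * (1 + l1norm Q / Cmod b)))%R
        with (Cmod b * Cmod x + Cmod x * l1norm Q)%R by (field; lra).
      assert (0 <= Cmod b * Cmod x)%R by (apply Rmult_le_pos; lra). lra. }
    assert (Cmod x * Cmod (peval Q x) <= Cmod x * l1norm Q)%R
      by (apply Rmult_le_compat_l; lra).
    assert (Cmod b * (Cmod x * K) <= Cmod b * / 2)%R by (apply Rmult_le_compat_l; lra).
    lra. }
  assert (HQ0 : peval (b :: Q) x <> 0) by (apply Cmod_gt_0; lra).
  intros eps He.
  set (W := (l1norm P * (2 / Cmod b))%R).
  assert (HW : (0 <= W)%R).
  { apply Rmult_le_pos; [apply l1norm_ge0|]. left. apply Rdiv_lt_0_compat; lra. }
  destruct (pow_lt_1_zero (/ 2) ltac:(rewrite Rabs_pos_eq; lra) (eps / (W + 1))%R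
              ltac:(apply Rdiv_lt_0_compat; lra)) as [N HN].
  exists N. intros n Hn. specialize (HN n Hn).
  rewrite Rabs_pos_eq in HN by (apply pow_le; lra).
  replace (psum (division_coef b Q P) x n - peval P x / peval (b :: Q) x)
    with (- (x ^ n * peval (division_remainder b Q P n) x / peval (b :: Q) x)).
  2:{ rewrite (division_remainder_spec Q P x n Hb). field. exact HQ0. }
  rewrite Cmod_opp, Cmod_div, Cmod_mult, Cmod_pow by exact HQ0.
  apply Rle_lt_trans with (W * (/ 2) ^ n)%R.
  - pose proof (peval_le_l1norm (division_remainder b Q P n) Hx1) as H1.
    pose proof (l1norm_division_remainder Q P n Hb) as H2. fold K in H2.
    apply Rle_trans with (Cmod x ^ n * (l1norm P * K ^ n) * (2 / Cmod b))%R.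
    + unfold Rdiv at 1. apply Rmult_le_compat.
      * apply Rmult_le_pos; [now apply pow_le | apply Cmod_ge_0].
      * left. apply Rinv_0_lt_compat. lra.
      * apply Rmult_le_compat_l; [now apply pow_le | lra].
      * replace (2 / Cmod b)%R with (/ (Cmod b / 2))%R by (field; lra).
        apply Rinv_le_contravar; lra.
    + replace (Cmod x ^ n * (l1norm P * K ^ n) * (2 / Cmod b))%R
        with (W * (Cmod x * K) ^ n)%R by (unfold W; rewrite Rpow_mult_distr; ring).
      apply Rmult_le_compat_l; [exact HW|]. apply pow_incr. split; [nra | lra].
  - assert (H3 : ((W + 1) * (/ 2) ^ n < eps)%R).
    { apply Rmult_lt_reg_r with (/ (W + 1))%R; [apply Rinv_0_lt_compat; lra|].
      eapply Rle_lt_trans; [|exact HN]. right. field. lra. }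
    pose proof (pow_lt (/ 2) n ltac:(lra)). lra.
Qed.

Definition polynomial (F : C -> C) : Prop :=
  exists l : list C, forall z, F z = peval l z.

Lemma polynomial_const (c : C) : polynomial (fun _ => c).
Proof. exists (c :: nil). intros z. simpl. ring. Qed.

Lemma polynomial_id : polynomial (fun z => z).
Proof. exists (RtoC 0 :: RtoC 1 :: nil). intros z. simpl. ring. Qed.

Lemma polynomial_add (F G : C -> C) :
  polynomial F -> polynomial G -> polynomial (fun z => F z + G z).
Proof.
  intros [l Hl] [m Hm]. exists (padd l m). intros z.
  now rewrite peval_padd, Hl, Hm.
Qed.

Lemma polynomial_mul (F G : C -> C) :
  polynomial F -> polynomial G -> polynomial (fun z => F z * G z).
Proof.
  intros [l Hl] [m Hm].
  assert (H : exists q, forall z, peval l z * peval m z = peval q z).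
  { clear F G Hl Hm. induction l as [|a l [q Hq]].
    - exists nil. intros z. simpl. ring.
    - exists (padd (pscale a m) (RtoC 0 :: q)). intros z.
      rewrite peval_padd, peval_pscale. simpl. rewrite <- Hq. ring. }
  destruct H as [q Hq]. exists q. intros z. now rewrite Hl, Hm.
Qed.

Lemma polynomial_shift (F : C -> C) (p : C) :
  polynomial F -> polynomial (fun h => F (p + h)).
Proof.
  intros [l Hl].
  assert (H : polynomial (fun h => peval l (p + h))).
  { clear F Hl. induction l as [|a l IH]; simpl.
    - apply polynomial_const.
    - apply polynomial_add; [apply polynomial_const|].
      apply polynomial_mul; [|exact IH].
      apply polynomial_add; [apply polynomial_const | apply polynomial_id]. }
  destruct H as [m Hm]. exists m. intros h. now rewrite Hl.
Qed.

Definition rational_on_disk (f : C -> C) : Prop :=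
  exists F G : C -> C, polynomial F /\ polynomial G /\
    forall z, (Cmod z < 1)%R -> G z <> 0 /\ f z = F z / G z.

Lemma rational_const (c : C) : rational_on_disk (fun _ => c).
Proof.
  exists (fun _ => c), (fun _ => 1).
  split; [apply polynomial_const|]. split; [apply polynomial_const|].
  intros z _. split; [apply C1_nz | field].
Qed.

Lemma rational_id : rational_on_disk (fun z => z).
Proof.
  exists (fun z => z), (fun _ => 1).
  split; [apply polynomial_id|]. split; [apply polynomial_const|].
  intros z _. split; [apply C1_nz | field].
Qed.

Lemma rational_mul (f g : C -> C) :
  rational_on_disk f -> rational_on_disk g -> rational_on_disk (fun z => f z * g z).
Proof.
  intros [F1 [G1 [HF1 [HG1 H1]]]] [F2 [G2 [HF2 [HG2 H2]]]].
  exists (fun z => F1 z * F2 z), (fun z => G1 z * G2 z).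
  split; [now apply polynomial_mul|]. split; [now apply polynomial_mul|].
  intros z Hz. destruct (H1 z Hz) as [N1 E1]. destruct (H2 z Hz) as [N2 E2].
  split; [now apply Cmult_neq_0|]. rewrite E1, E2. field. now split.
Qed.

Lemma rational_T (f : C -> C) (a : C) :
  (Cmod a < 1)%R -> (forall z, (Cmod z < 1)%R -> (Cmod (f z) <= 1)%R) ->
  rational_on_disk f -> rational_on_disk (fun z => T a (f z)).
Proof.
  intros Ha Hf [F [G [HF [HG H]]]].
  exists (fun z => F z + a * G z), (fun z => G z + Cconj a * F z).
  split; [|split].
  - apply polynomial_add; [exact HF|]. apply polynomial_mul; [apply polynomial_const | exact HG].
  - apply polynomial_add; [exact HG|]. apply polynomial_mul; [apply polynomial_const | exact HF].
  - intros z Hz. destruct (H z Hz) as [N E].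
    pose proof (T_den_ne0 Ha (Hf z Hz)) as Hd.
    assert (ED : G z + Cconj a * F z = G z * (1 + Cconj a * f z)).
    { rewrite E. field. exact N. }
    assert (HD : G z + Cconj a * F z <> 0) by (rewrite ED; now apply Cmult_neq_0).
    split; [exact HD|]. rewrite E in *. unfold T. field. repeat split; assumption.
Qed.

Lemma rational_analytic (f : C -> C) : rational_on_disk f -> analytic_on unit_disk f.
Proof.
  intros [F [G [HF [HG H]]]] z Hz. rewrite unit_disk_iff in Hz.
  destruct (polynomial_shift z HF) as [P HP]. destruct (polynomial_shift z HG) as [Q HQ].
  assert (HQ0 : peval Q 0 <> 0).
  { rewrite <- HQ, Cplus_0_r. exact (proj1 (H z Hz)). }
  destruct Q as [|b Q]; [now elim HQ0|].
  assert (Hb : b <> 0) by (intros ->; apply HQ0; simpl; ring).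
  destruct (quotient_has_pseries Q P Hb) as [d [Hd Hs]].
  exists (division_coef b Q P), (Rmin d (1 - Cmod z)). split; [apply Rmin_glb_lt; lra|].
  intros h Hh. apply is_pseries_psums.
  assert (Hzh : (Cmod (z + h) < 1)%R).
  { eapply Rle_lt_trans; [apply Cmod_triangle|]. pose proof (Rmin_r d (1 - Cmod z)). lra. }
  destruct (H _ Hzh) as [_ E]. rewrite E, HP, HQ.
  apply Hs. eapply Rlt_le_trans; [exact Hh | apply Rmin_l].
Qed.

(** * Third order expansions *)

(** All expansions have the same order, so that they compose without bookkeeping of
    orders. *)
Definition expands (f : C -> C) (c0 c1 c2 c3 : C) : Prop :=
  exists g : C -> C, bounded0 g /\
    near0 (fun h => f h = c0 + c1 * h + c2 * h ^ 2 + c3 * h ^ 3 + h ^ 4 * g h).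

Lemma expands_ext (f g : C -> C) (c0 c1 c2 c3 : C) :
  near0 (fun h => f h = g h) -> expands f c0 c1 c2 c3 -> expands g c0 c1 c2 c3.
Proof.
  intros E [r [Hr H]]. exists r. split; [exact Hr|].
  apply near0_mono with (2 := near0_and E H). intros h [H1 H2]. congruence.
Qed.

Lemma expands_coefs (f : C -> C) (c0 c1 c2 c3 d0 d1 d2 d3 : C) :
  c0 = d0 -> c1 = d1 -> c2 = d2 -> c3 = d3 ->
  expands f c0 c1 c2 c3 -> expands f d0 d1 d2 d3.
Proof. now intros -> -> -> ->. Qed.

Lemma expands_at0 (f : C -> C) (c0 c1 c2 c3 : C) : expands f c0 c1 c2 c3 -> f 0 = c0.
Proof. intros [g [_ H]]. rewrite (near0_at H). ring. Qed.

Lemma expands_const (c : C) : expands (fun _ => c) c 0 0 0.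
Proof.
  exists (fun _ => 0). split; [apply bounded0_const|].
  exists 1%R. split; [lra|]. intros; ring.
Qed.

Lemma expands_id : expands (fun h => h) 0 1 0 0.
Proof.
  exists (fun _ => 0). split; [apply bounded0_const|].
  exists 1%R. split; [lra|]. intros; ring.
Qed.

Ltac bounded0_tac :=
  repeat first [ apply bounded0_const | apply bounded0_id | assumption
               | apply bounded0_add | apply bounded0_mul ].

Lemma expands_add (f g : C -> C) (a0 a1 a2 a3 b0 b1 b2 b3 : C) :
  expands f a0 a1 a2 a3 -> expands g b0 b1 b2 b3 ->
  expands (fun h => f h + g h) (a0 + b0) (a1 + b1) (a2 + b2) (a3 + b3).
Proof.
  intros [r [Hr Ef]] [s [Hs Eg]]. exists (fun h => r h + s h). split.
  - bounded0_tac.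
  - apply near0_mono with (2 := near0_and Ef Eg). intros h [H1 H2].
    rewrite H1, H2. ring.
Qed.

Lemma expands_mul (f g : C -> C) (a0 a1 a2 a3 b0 b1 b2 b3 : C) :
  expands f a0 a1 a2 a3 -> expands g b0 b1 b2 b3 ->
  expands (fun h => f h * g h) (a0 * b0) (a0 * b1 + a1 * b0)
    (a0 * b2 + a1 * b1 + a2 * b0) (a0 * b3 + a1 * b2 + a2 * b1 + a3 * b0).
Proof.
  intros [r [Hr Ef]] [s [Hs Eg]].
  exists (fun h => a1 * b3 + a2 * b2 + a3 * b1 + h * (a2 * b3 + a3 * b2) + h * h * (a3 * b3)
    + (a0 + a1 * h + a2 * (h * h) + a3 * (h * (h * h))) * s h
    + r h * (b0 + b1 * h + b2 * (h * h) + b3 * (h * (h * h)))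
    + h * h * (h * h) * (r h * s h)).
  split; [bounded0_tac|].
  apply near0_mono with (2 := near0_and Ef Eg). intros h [H1 H2].
  rewrite H1, H2. ring.
Qed.

Lemma expands_bounded (f : C -> C) (c0 c1 c2 c3 : C) : expands f c0 c1 c2 c3 -> bounded0 f.
Proof.
  intros [g [Hg E]].
  apply bounded0_ext with
    (fun h => c0 + c1 * h + c2 * (h * h) + c3 * (h * (h * h)) + h * (h * (h * h)) * g h).
  - apply near0_mono with (2 := E). intros h H. rewrite H. ring.
  - bounded0_tac.
Qed.

Lemma expands_jet1 (f : C -> C) (c0 c1 c2 c3 : C) : expands f c0 c1 c2 c3 -> jet 1 f.
Proof.
  intros [g [Hg E]]. exists c0, (fun h => c1 + c2 * h + c3 * (h * h) + h * (h * h) * g h).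
  split; [simpl; bounded0_tac|].
  apply near0_mono with (2 := E). intros h H. rewrite H. ring.
Qed.

Lemma jet_expands (f : C -> C) :
  jet 4 f -> exists c1 c2 c3 : C, expands f (f 0) c1 c2 c3.
Proof.
  intros [c0 [f1 [[c1 [f2 [[c2 [f3 [[c3 [g [Hg E3]]] E2]]] E1]]] E0]]].
  exists c1, c2, c3.
  replace (f 0) with c0 by (rewrite (near0_at E0); ring).
  exists g. split; [exact Hg|].
  apply near0_mono with (2 := near0_and E0 (near0_and E1 (near0_and E2 E3))).
  intros h [H0 [H1 [H2 H3]]]. rewrite H0, H1, H2, H3. ring.
Qed.

Lemma bounded_remainder_zero (c : C) (g : C -> C) :
  bounded0 g -> near0 (fun h => h <> 0 -> c + h * g h = 0) ->
  c = 0 /\ near0 (fun h => h <> 0 -> g h = 0).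
Proof.
  intros Hg E. assert (Hc : c = 0).
  { set (f := fun h => if Ceq_dec h 0 then c else c + h * g h).
    assert (E1 : f 0 = 0).
    { apply (jet1_unique (g := fun _ => 0)); [|apply jet_const|].
      - exists c, g. split; [exact Hg|]. exists 1%R. split; [lra|]. intros h _. unfold f.
        destruct (Ceq_dec h 0) as [->|]; ring.
      - apply near0_mono with (2 := E). intros h H Hh. unfold f.
        destruct (Ceq_dec h 0) as [|_]; [contradiction | now apply H]. }
    unfold f in E1. destruct (Ceq_dec 0 0) as [_|n]; [exact E1 | now elim n]. }
  split; [exact Hc|].
  apply near0_mono with (2 := E). intros h H Hh. specialize (H Hh).
  rewrite Hc, Cplus_0_l in H.
  replace (g h) with (/ h * (h * g h)) by (field; exact Hh). rewrite H. ring.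
Qed.

(** One factor [h] is peeled off at a time. The quotients are then compared for [h <> 0]
    only, which determines their value at [0] because the remainders are bounded. *)
Lemma expands_unique (f : C -> C) (a0 a1 a2 a3 b0 b1 b2 b3 : C) :
  expands f a0 a1 a2 a3 -> expands f b0 b1 b2 b3 ->
  a1 = b1 /\ a2 = b2 /\ a3 = b3.
Proof.
  intros [r [Hr Er]] [s [Hs Es]].
  set (d := fun h => r h + - (1) * s h).
  assert (Hd : bounded0 d) by (unfold d; bounded0_tac).
  assert (E0 : near0 (fun h => h <> 0 ->
    (a0 - b0) + h * ((a1 - b1) + h * ((a2 - b2) + h * ((a3 - b3) + h * d h))) = 0)).
  { apply near0_mono with (2 := near0_and Er Es). intros h [H1 H2] _.
    rewrite H1 in H2. unfold d.
    match type of H2 with ?x = ?y => transitivity (x - y) end; [ring|].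
    rewrite H2. ring. }
  apply bounded_remainder_zero in E0; [|bounded0_tac]. destruct E0 as [_ E1].
  apply bounded_remainder_zero in E1; [|bounded0_tac]. destruct E1 as [D1 E2].
  apply bounded_remainder_zero in E2; [|bounded0_tac]. destruct E2 as [D2 E3].
  apply bounded_remainder_zero in E3; [|bounded0_tac]. destruct E3 as [D3 _].
  repeat split; apply Cmod_sub_le0; [rewrite D1|rewrite D2|rewrite D3]; rewrite Cmod_0; lra.
Qed.

Lemma expands_T (x : C -> C) (a x1 x2 x3 : C) :
  expands x 0 x1 x2 x3 ->
  expands (fun h => T a (x h)) a ((1 - a * Cconj a) * x1)
    ((1 - a * Cconj a) * (x2 - Cconj a * x1 ^ 2))
    ((1 - a * Cconj a) * (x3 - 2 * Cconj a * x1 * x2 + Cconj a ^ 2 * x1 ^ 3)).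
Proof.
  intros Hx.
  assert (Hden : expands (fun h => 1 + Cconj a * x h) 1 (Cconj a * x1) (Cconj a * x2) (Cconj a * x3)).
  { eapply expands_coefs; [| | | |exact (expands_add (expands_const 1)
      (expands_mul (expands_const (Cconj a)) Hx))]; ring. }
  assert (H0 : 1 + Cconj a * x 0 <> 0).
  { rewrite (expands_at0 Hden). apply C1_nz. }
  assert (Hinv : bounded0 (fun h => / (1 + Cconj a * x h))).
  { apply (@jet_inv 0 (fun h => 1 + Cconj a * x h)); [|exact H0|].
    - exact (expands_jet1 Hden).
    - exact (expands_bounded Hden). }
  assert (Hnz : near0 (fun h => 1 + Cconj a * x h <> 0)).
  { apply near0_mono with (2 := jet1_away (expands_jet1 Hden) H0). intros h Hh Hc.
    rewrite Hc, Cmod_0 in Hh. pose proof (Cmod_ge_0 (1 + Cconj a * x 0)). lra. }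
  set (q := fun h => / (1 + Cconj a * x h)) in *.
  (* T_a(x) agrees with its cubic Taylor polynomial in x up to a multiple of x^4 *)
  assert (Hx2 := expands_mul Hx Hx). assert (Hx3 := expands_mul Hx Hx2).
  assert (Hcube := expands_add (expands_const a) (expands_mul (expands_const (1 - a * Cconj a))
    (expands_add Hx (expands_add (expands_mul (expands_const (- Cconj a)) Hx2)
      (expands_mul (expands_const (Cconj a ^ 2)) Hx3))))).
  destruct Hx as [r [Hr Er]].
  set (y := fun h => x1 + x2 * h + x3 * (h * h) + h * (h * h) * r h).
  assert (Hy : bounded0 y) by (unfold y; bounded0_tac).
  destruct Hcube as [s [Hs Es]].
  exists (fun h => s h + - (1 - a * Cconj a) * (Cconj a ^ 3) * (y h * y h * (y h * y h)) * q h).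
  split; [bounded0_tac|].
  apply near0_mono with (2 := near0_and (near0_and Er Es) Hnz). intros h [[E1 E2] E3].
  assert (Exy : x h = h * y h) by (rewrite E1; unfold y; ring).
  transitivity (a + (1 - a * Cconj a) * (x h + (- Cconj a * (x h * x h)
     + Cconj a ^ 2 * (x h * (x h * x h)))) - (1 - a * Cconj a) * Cconj a ^ 3 * x h ^ 4 * q h).
  - unfold T, q. field. exact E3.
  - rewrite E2. rewrite Exy. ring.
Qed.

Lemma expands_T_sub (p : C) :
  (Cmod p < 1)%R ->
  let d := 1 - p * Cconj p in
  expands (fun h => T (- p) (p + h)) 0 (/ d) (Cconj p / d ^ 2) (Cconj p ^ 2 / d ^ 3).
Proof.
  intros Hp d. pose proof (one_sub_conj_ne0 Hp) as Hd. fold d in Hd.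
  assert (J : forall n, jet n (fun h => d + - Cconj p * h)).
  { intros n. apply jet_add; [apply jet_const|].
    apply jet_mul; [apply jet_const | apply jet_id]. }
  assert (H0 : d + - Cconj p * 0 <> 0) by (replace (d + - Cconj p * 0) with d by ring; exact Hd).
  exists (fun h => Cconj p ^ 3 / d ^ 3 * / (d + - Cconj p * h)). split.
  - apply bounded0_mul; [apply bounded0_const|].
    apply (@jet_inv 0 (fun h => d + - Cconj p * h)); [apply J | exact H0 | apply (J 0%nat)].
  - apply near0_mono with (2 := jet1_away (J 1%nat) H0). intros h Hh.
    assert (Hn : d + - Cconj p * h <> 0).
    { intros Hc. rewrite Hc, Cmod_0 in Hh. pose proof (Cmod_ge_0 (d + - Cconj p * 0)). lra. }
    unfold T. rewrite Copp_conj.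
    replace (1 + - Cconj p * (p + h)) with (d + - Cconj p * h) by (unfold d; ring).
    replace (p + h + - p) with h by ring. field. now split.
Qed.

(** One stage of the Schur algorithm, read on the coefficients: the constant term of [y]
    determines the first order coefficient of the result, and so on with a shift by one,
    since [T (- p)] vanishes at [p]. *)
Lemma expands_schur_stage (p a : C) (y : C -> C) (y0 y1 y2 y3 : C) :
  (Cmod p < 1)%R -> expands (fun h => y (p + h)) y0 y1 y2 y3 ->
  let d := 1 - p * Cconj p in
  let x1 := y0 / d in
  let x2 := y1 / d + Cconj p * y0 / d ^ 2 in
  let x3 := y2 / d + Cconj p * y1 / d ^ 2 + Cconj p ^ 2 * y0 / d ^ 3 in
  expands (fun h => T a (T (- p) (p + h) * y (p + h))) a ((1 - a * Cconj a) * x1)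
    ((1 - a * Cconj a) * (x2 - Cconj a * x1 ^ 2))
    ((1 - a * Cconj a) * (x3 - 2 * Cconj a * x1 * x2 + Cconj a ^ 2 * x1 ^ 3)).
Proof.
  intros Hp Hy d x1 x2 x3. pose proof (one_sub_conj_ne0 Hp) as Hd. fold d in Hd.
  apply (expands_T (x := fun h => T (- p) (p + h) * y (p + h))).
  eapply expands_coefs; [| | | |exact (expands_mul (expands_T_sub Hp) Hy)]; fold d;
    unfold x1, x2, x3; field; exact Hd.
Qed.

Lemma has_pseries_expands (a : nat -> C) (delta : R) (f : C -> C) :
  has_pseries a delta f -> expands f (a 0%nat) (a 1%nat) (a 2%nat) (a 3%nat).
Proof.
  intros H.
  destruct (has_pseries_shift H) as [f1 [H1 E1]].
  destruct (has_pseries_shift H1) as [f2 [H2 E2]].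
  destruct (has_pseries_shift H2) as [f3 [H3 E3]].
  destruct (has_pseries_shift H3) as [f4 [H4 E4]].
  exists f4. split; [exact (has_pseries_jet 0 H4)|].
  exists delta. split; [apply H|]. intros h Hh.
  rewrite E1, E2, E3, E4 by exact Hh. ring.
Qed.

Lemma analytic_has_pseries (f : C -> C) (z : C) :
  analytic_on unit_disk f -> (Cmod z < 1)%R ->
  exists a delta, has_pseries a delta (fun h => f (z + h)).
Proof.
  intros Hf Hz. destruct (Hf z (proj2 (unit_disk_iff z) Hz)) as [a [d [Hd H]]].
  exists a, d. split; [exact Hd|]. intros h Hh. apply is_pseries_psums. now apply H.
Qed.

Lemma analytic_smooth (f : C -> C) (z : C) :
  analytic_on unit_disk f -> (Cmod z < 1)%R -> smooth f z.
Proof.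
  intros Hf Hz n. destruct (analytic_has_pseries Hf Hz) as [a [d H]].
  exact (has_pseries_jet n H).
Qed.

(** An expansion and a convergent power series of the same function have the same
    coefficients, and the series may be differentiated termwise. *)
Lemma derivatives_of_expansion (f : C -> C) (z c0 c1 c2 c3 : C) :
  analytic_on unit_disk f -> (Cmod z < 1)%R ->
  expands (fun h => f (z + h)) c0 c1 c2 c3 ->
  C_derive_n f 1 z = c1 /\ C_derive_n f 2 z = 2 * c2 /\ C_derive_n f 3 z = 6 * c3.
Proof.
  intros Hf Hz He. destruct (analytic_has_pseries Hf Hz) as [a [d H]].
  destruct (expands_unique He (has_pseries_expands H)) as [-> [-> ->]].
  assert (At0 : forall b e g, has_pseries b e (fun h => g (z + h)) -> g z = b 0%nat).
  { intros b e g Hg. pose proof (expands_at0 (has_pseries_expands Hg)) as E.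
    cbv beta in E. now rewrite Cplus_0_r in E. }
  destruct (has_pseries_derive H) as [d1 H1].
  destruct (has_pseries_derive H1) as [d2 H2].
  destruct (has_pseries_derive H2) as [d3 H3].
  unfold C_derive_n. simpl.
  rewrite (At0 _ _ _ H1), (At0 _ _ _ H2), (At0 _ _ _ H3).
  unfold dcoef. simpl INR. rewrite ?RtoC_plus.
  repeat split; ring.
Qed.

(** * Self-maps of the disk with a prescribed second order jet *)

Lemma H0_factor (f : C -> C) :
  H0 f -> exists g : C -> C, schur g /\
    forall z, (Cmod z < 1)%R -> f z = z * g z.
Proof.
  intros [Ha [Hm H00]].
  assert (Hs : schur f).
  { intros z Hz. split; [now apply analytic_smooth|]. left.
    apply unit_disk_iff, Hm. now apply unit_disk_iff. }
  destruct (@schwarz_division f 0 Hs) as [g [Hg E]]; [rewrite Cmod_0; lra | exact H00 |].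
  exists g. split; [exact Hg|]. intros z Hz. rewrite (E z Hz). unfold T.
  rewrite Copp_conj.
  replace (Cconj 0) with (RtoC 0) by (unfold Cconj, RtoC; simpl; f_equal; ring).
  replace (1 + - 0 * z) with (RtoC 1) by ring. field.
Qed.

Lemma schur_expands (k : C -> C) (p : C) :
  schur k -> (Cmod p < 1)%R ->
  exists c1 c2 c3 : C, expands (fun h => k (p + h)) (k p) c1 c2 c3.
Proof.
  intros Hk Hp. destruct (jet_expands (proj1 (Hk p Hp) 4%nat)) as [c1 [c2 [c3 E]]].
  exists c1, c2, c3. now rewrite Cplus_0_r in E.
Qed.

Lemma outer_derivatives (f y : C -> C) (p u y0 y1 y2 y3 : C) :
  analytic_on unit_disk f -> (Cmod p < 1)%R ->
  (forall z, (Cmod z < 1)%R -> f z = z * T u (T (- p) z * y z)) ->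
  expands (fun h => y (p + h)) y0 y1 y2 y3 ->
  let d := 1 - p * Cconj p in
  let x1 := y0 / d in
  let x2 := y1 / d + Cconj p * y0 / d ^ 2 in
  let x3 := y2 / d + Cconj p * y1 / d ^ 2 + Cconj p ^ 2 * y0 / d ^ 3 in
  let t1 := (1 - u * Cconj u) * x1 in
  let t2 := (1 - u * Cconj u) * (x2 - Cconj u * x1 ^ 2) in
  let t3 := (1 - u * Cconj u) * (x3 - 2 * Cconj u * x1 * x2 + Cconj u ^ 2 * x1 ^ 3) in
  C_derive_n f 1 p = u + p * t1 /\ C_derive_n f 2 p = 2 * (t1 + p * t2) /\
  C_derive_n f 3 p = 6 * (t2 + p * t3).
Proof.
  intros Hf Hp E Hy d x1 x2 x3 t1 t2 t3.
  pose proof (expands_schur_stage u Hp Hy) as Hst.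
  apply derivatives_of_expansion with (c0 := p * u); [exact Hf | exact Hp|].
  apply expands_ext with (fun h => (p + h) * T u (T (- p) (p + h) * y (p + h))).
  - exists (1 - Cmod p)%R. split; [lra|]. intros h Hh. symmetry. apply E.
    eapply Rle_lt_trans; [apply Cmod_triangle | lra].
  - eapply expands_coefs; [| | | |exact (expands_mul
      (expands_add (expands_const p) expands_id) Hst)];
      unfold t1, t2, t3, x1, x2, x3, d; ring.
Qed.

(** Squared moduli are written as [z * Cconj z], so that the identities below hold in the
    field of rational functions in the variables and their conjugates. *)
Definition defect (z : C) : C := 1 - z * Cconj z.
Definition sqr_gap (z w : C) : C := z * Cconj z - w * Cconj w.

Definition first_datum (z w l : C) : C := w / z + sqr_gap z w / (z * defect z) * l.

Definition second_datum (z w l m : C) : C :=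
  2 * sqr_gap z w * l * (1 - Cconj w * l) / (z ^ 2 * defect z ^ 2)
  + 2 * sqr_gap z w * defect l / (z * defect z ^ 2) * m.

Definition third_center (z w l m : C) : C :=
  6 * sqr_gap z w / (z ^ 3 * defect z ^ 3)
  * (Cconj w ^ 2 * l ^ 3 - Cconj w * (1 + z * Cconj z) * l ^ 2 + z * Cconj z * l
     + z * m * defect l * (1 + z * Cconj z - 2 * Cconj w * l - z * Cconj l * m)).

Definition third_slope (z w l m : C) : C :=
  6 * sqr_gap z w * defect l * defect m / (Cconj z * defect z ^ 3).

(** The Schur parameter at [z] that belongs to the datum [l]. *)
Definition twist (z l : C) : C := Cconj z * l / z.

Lemma Cconj_ne0 (z : C) : z <> 0 -> Cconj z <> 0.
Proof. intros H. apply Cmod_gt_0. rewrite Cmod_conj. now apply Cmod_gt_0. Qed.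

Lemma Cmod_twist (z l : C) : z <> 0 -> Cmod (twist z l) = Cmod l.
Proof.
  intros Hz. unfold twist. rewrite Cmod_div, Cmod_mult, Cmod_conj by exact Hz.
  apply Cmod_gt_0 in Hz. field. lra.
Qed.

Lemma twist_conj (z l : C) : z <> 0 -> Cconj (twist z l) = z * Cconj l / Cconj z.
Proof.
  intros Hz. unfold twist. now rewrite Cdiv_conj, Cmult_conj, Cconj_conj by exact Hz.
Qed.

Lemma defect_twist (z l : C) : z <> 0 -> defect (twist z l) = defect l.
Proof.
  intros Hz. unfold defect. rewrite twist_conj by exact Hz. unfold twist.
  pose proof (Cconj_ne0 Hz). field. now split.
Qed.

Lemma sqr_gap_ne0 (z w : C) : (Cmod w < Cmod z)%R -> sqr_gap z w <> 0.
Proof.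
  intros H Hc. unfold sqr_gap in Hc. rewrite !conj_mul_self in Hc.
  rewrite <- RtoC_minus in Hc. apply RtoC_inj in Hc.
  pose proof (Cmod_ge_0 w). simpl in Hc. nra.
Qed.

(** The algebraic heart. The coefficients of [y] are those of
    [T (twist z l) (t * q)], for [q] with value [twist z m] and derivative [e1] at [z];
    keeping them in this form, with [y] itself arbitrary, covers the cases where the
    algorithm stops early, since [defect l] or [defect m] then vanishes. *)
Lemma derivatives_of_parameters (f y : C -> C) (z w l m sigma y3 : C) :
  analytic_on unit_disk f -> (Cmod z < 1)%R -> z <> 0 ->
  (forall x, (Cmod x < 1)%R -> f x = x * T (w / z) (T (- z) x * y x)) ->
  let e := twist z m in
  let e1 := defect m * sigma / defect z in
  expands (fun h => y (z + h)) (twist z l) (defect l * e / defect z)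
    (defect l * (e1 / defect z + Cconj z * e / defect z ^ 2
             - Cconj (twist z l) * (e / defect z) ^ 2)) y3 ->
  C_derive_n f 1 z = first_datum z w l /\
  C_derive_n f 2 z = second_datum z w l m /\
  C_derive_n f 3 z = third_center z w l m + third_slope z w l m * sigma.
Proof.
  intros Hf Hz Hz0 E e e1 Hy.
  destruct (outer_derivatives Hf Hz E Hy) as [-> [-> ->]].
  pose proof (one_sub_conj_ne0 Hz) as Hd. pose proof (Cconj_ne0 Hz0) as Hc.
  unfold e, e1. rewrite twist_conj, Cdiv_conj by exact Hz0.
  unfold first_datum, second_datum, third_center, third_slope, twist, defect, sqr_gap.
  repeat split; field; repeat split; assumption.
Qed.

Lemma derivatives_of_second_parameter (f q : C -> C) (z w l m sigma q2 q3 : C) :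
  analytic_on unit_disk f -> (Cmod z < 1)%R -> z <> 0 ->
  (forall x, (Cmod x < 1)%R ->
     f x = x * T (w / z) (T (- z) x * T (twist z l) (T (- z) x * q x))) ->
  expands (fun h => q (z + h)) (twist z m) (defect m * sigma / defect z) q2 q3 ->
  C_derive_n f 1 z = first_datum z w l /\
  C_derive_n f 2 z = second_datum z w l m /\
  C_derive_n f 3 z = third_center z w l m + third_slope z w l m * sigma.
Proof.
  intros Hf Hz Hz0 E Hq.
  pose proof (one_sub_conj_ne0 Hz) as Hd.
  eapply (@derivatives_of_parameters f (fun x => T (twist z l) (T (- z) x * q x)));
    [exact Hf | exact Hz | exact Hz0 | exact E |].
  eapply expands_coefs; [| | | |exact (expands_schur_stage (twist z l) Hz Hq)];
    [reflexivity | | | reflexivity];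
    change (1 - twist z l * Cconj (twist z l)) with (defect (twist z l));
    rewrite (defect_twist l Hz0); unfold defect at 3; unfold defect in Hd; fold (defect z) in *; field; exact Hd.
Qed.

Lemma derivatives_of_third_parameter (f k : C -> C) (z w l m : C) :
  analytic_on unit_disk f -> (Cmod z < 1)%R -> z <> 0 -> schur k ->
  (forall x, (Cmod x < 1)%R ->
     f x = x * T (w / z) (T (- z) x * T (twist z l) (T (- z) x * T (twist z m) (T (- z) x * k x)))) ->
  C_derive_n f 1 z = first_datum z w l /\
  C_derive_n f 2 z = second_datum z w l m /\
  C_derive_n f 3 z = third_center z w l m + third_slope z w l m * k z.
Proof.
  intros Hf Hz Hz0 Hk E.
  pose proof (one_sub_conj_ne0 Hz) as Hd.
  destruct (schur_expands Hk Hz) as [c1 [c2 [c3 Hke]]].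
  eapply (@derivatives_of_second_parameter f (fun x => T (twist z m) (T (- z) x * k x)));
    [exact Hf | exact Hz | exact Hz0 | exact E |].
  eapply expands_coefs; [| | | |exact (expands_schur_stage (twist z m) Hz Hke)];
    [reflexivity | | reflexivity | reflexivity].
  change (1 - twist z m * Cconj (twist z m)) with (defect (twist z m)).
  rewrite (defect_twist m Hz0). unfold defect at 3. field. exact Hd.
Qed.

(** The value [y z] enters the first derivative of [f] linearly, with a coefficient that is
    non-zero because [|w| < |z|]. *)
Lemma first_parameter (f : C -> C) (z w l : C) :
  H0 f -> (Cmod z < 1)%R -> (Cmod w < Cmod z)%R ->
  f z = w -> C_derive_n f 1 z = first_datum z w l ->
  exists y : C -> C, schur y /\ y z = twist z l /\
    forall x, (Cmod x < 1)%R -> f x = x * T (w / z) (T (- z) x * y x).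
Proof.
  intros Hf Hz Hwz Hfz HD.
  assert (Hz0 : z <> 0) by (apply Cmod_gt_0; pose proof (Cmod_ge_0 w); lra).
  destruct (H0_factor Hf) as [g [Hg Eg]].
  assert (Hgz : g z = w / z) by (rewrite <- Hfz, (Eg z Hz); field; exact Hz0).
  assert (Hu : (Cmod (g z) < 1)%R).
  { rewrite Hgz, Cmod_div by exact Hz0. apply Cmod_gt_0 in Hz0.
    apply Rmult_lt_reg_r with (Cmod z); [exact Hz0|].
    unfold Rdiv. rewrite Rmult_assoc, Rinv_l by lra. lra. }
  destruct (schur_step Hg Hz Hu) as [y [Hy Ey]]. rewrite Hgz in Ey.
  assert (E : forall x, (Cmod x < 1)%R -> f x = x * T (w / z) (T (- z) x * y x)).
  { intros x Hx. rewrite (Eg x Hx), (Ey x Hx). reflexivity. }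
  exists y. split; [exact Hy|]. split; [|exact E].
  destruct (schur_expands Hy Hz) as [c1 [c2 [c3 Hye]]].
  destruct (outer_derivatives (proj1 Hf) Hz E Hye) as [D1 _].
  rewrite HD, Cdiv_conj in D1 by exact Hz0.
  pose proof (one_sub_conj_ne0 Hz) as Hd. pose proof (Cconj_ne0 Hz0) as Hc.
  pose proof (sqr_gap_ne0 Hwz) as Hzw.
  unfold sqr_gap in Hzw.
  transitivity ((w / z + z * ((1 - w / z * (Cconj w / Cconj z)) * (y z / (1 - z * Cconj z))) - w / z)
    * ((1 - z * Cconj z) * Cconj z / (z * Cconj z - w * Cconj w))).
  - field. repeat split; assumption.
  - rewrite <- D1. unfold first_datum, twist, sqr_gap, defect. field. repeat split; assumption.
Qed.

Lemma defect_ne0 (l : C) : (Cmod l < 1)%R -> defect l <> 0.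
Proof. apply one_sub_conj_ne0. Qed.

(** As before, [q z] enters the second derivative linearly; the coefficient is non-zero
    because [|w| < |z|] and [|l| < 1]. *)
Lemma second_parameter (f : C -> C) (z w l m : C) :
  H0 f -> (Cmod z < 1)%R -> (Cmod w < Cmod z)%R -> (Cmod l < 1)%R ->
  f z = w -> C_derive_n f 1 z = first_datum z w l ->
  C_derive_n f 2 z = second_datum z w l m ->
  exists q : C -> C, schur q /\ q z = twist z m /\
    forall x, (Cmod x < 1)%R ->
      f x = x * T (w / z) (T (- z) x * T (twist z l) (T (- z) x * q x)).
Proof.
  intros Hf Hz Hwz Hl Hfz HD1 HD2.
  assert (Hz0 : z <> 0) by (apply Cmod_gt_0; pose proof (Cmod_ge_0 w); lra).
  destruct (first_parameter Hf Hz Hwz Hfz HD1) as [y [Hy [Hyz E]]].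
  destruct (@schur_step y z Hy Hz) as [q [Hq Eq]].
  { now rewrite Hyz, Cmod_twist. }
  rewrite Hyz in Eq. exists q. split; [exact Hq|].
  assert (E' : forall x, (Cmod x < 1)%R ->
      f x = x * T (w / z) (T (- z) x * T (twist z l) (T (- z) x * q x))).
  { intros x Hx. now rewrite (E x Hx), (Eq x Hx). }
  split; [|exact E'].
  destruct (schur_expands Hq Hz) as [c1 [c2 [c3 Hqe]]].
  assert (D2 := proj1 (proj2 (outer_derivatives
    (y := fun x => T (twist z l) (T (- z) x * q x)) (proj1 Hf) Hz E'
      (expands_schur_stage (twist z l) Hz Hqe)))).
  rewrite HD2, twist_conj, Cdiv_conj in D2 by exact Hz0.
  pose proof (one_sub_conj_ne0 Hz) as Hd. pose proof (Cconj_ne0 Hz0) as Hc.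
  pose proof (sqr_gap_ne0 Hwz) as Hzw. pose proof (defect_ne0 Hl) as Hdl.
  unfold sqr_gap in Hzw. unfold defect in Hdl.
  assert (HS : 2 * (z * Cconj z - w * Cconj w) * (1 - l * Cconj l)
                 / (Cconj z * (1 - z * Cconj z) ^ 2) * (q z - twist z m) = 0).
  { match type of D2 with ?a = ?b => transitivity (b - a); [|rewrite D2; ring] end.
    unfold second_datum, twist, sqr_gap, defect. field. repeat split; assumption. }
  apply Cmod_sub_le0.
  replace (q z - twist z m) with
    (2 * (z * Cconj z - w * Cconj w) * (1 - l * Cconj l)
       / (Cconj z * (1 - z * Cconj z) ^ 2) * (q z - twist z m)
     * (Cconj z * (1 - z * Cconj z) ^ 2
        / (2 * (z * Cconj z - w * Cconj w) * (1 - l * Cconj l)))).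
  - rewrite HS, Cmult_0_l, Cmod_0. lra.
  - field. repeat split; assumption.
Qed.

Lemma third_parameter (f : C -> C) (z w l m : C) :
  H0 f -> (Cmod z < 1)%R -> (Cmod w < Cmod z)%R -> (Cmod l < 1)%R -> (Cmod m < 1)%R ->
  f z = w -> C_derive_n f 1 z = first_datum z w l ->
  C_derive_n f 2 z = second_datum z w l m ->
  exists k : C -> C, schur k /\
    forall x, (Cmod x < 1)%R ->
      f x = x * T (w / z) (T (- z) x * T (twist z l) (T (- z) x * T (twist z m) (T (- z) x * k x))).
Proof.
  intros Hf Hz Hwz Hl Hm Hfz HD1 HD2.
  assert (Hz0 : z <> 0) by (apply Cmod_gt_0; pose proof (Cmod_ge_0 w); lra).
  destruct (second_parameter Hf Hz Hwz Hl Hfz HD1 HD2) as [q [Hq [Hqz E]]].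
  destruct (@schur_step q z Hq Hz) as [k [Hk Ek]].
  { now rewrite Hqz, Cmod_twist. }
  rewrite Hqz in Ek. exists k. split; [exact Hk|].
  intros x Hx. now rewrite (E x Hx), (Ek x Hx).
Qed.

(** * The extremal functions *)

Definition nested (z w l m sigma x : C) : C :=
  x * T (w / z) (T (- z) x * T (twist z l) (T (- z) x * T (twist z m) (T (- z) x * sigma))).

Lemma Cmod_mul_le1 (x y : C) :
  (Cmod x <= 1)%R -> (Cmod y <= 1)%R -> (Cmod (x * y) <= 1)%R.
Proof.
  intros Hx Hy. rewrite Cmod_mult.
  pose proof (Cmod_ge_0 x). pose proof (Cmod_ge_0 y). nra.
Qed.

(** Each Moebius map preserves the closed disk, so no denominator vanishes, and the factor
    [x] brings the values into the open disk. *)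
Lemma nested_H0 (z w l m sigma : C) :
  (Cmod z < 1)%R -> (Cmod w < Cmod z)%R -> (Cmod l < 1)%R -> (Cmod m < 1)%R ->
  (Cmod sigma <= 1)%R -> H0 (nested z w l m sigma) /\ nested z w l m sigma z = w.
Proof.
  intros Hz Hwz Hl Hm Hs.
  assert (Hz0 : z <> 0) by (apply Cmod_gt_0; pose proof (Cmod_ge_0 w); lra).
  assert (Hu : (Cmod (w / z) < 1)%R).
  { rewrite Cmod_div by exact Hz0. pose proof (proj1 (Cmod_gt_0 _) Hz0) as Hp.
    apply Rmult_lt_reg_r with (Cmod z); [exact Hp|].
    unfold Rdiv. rewrite Rmult_assoc, Rinv_l by lra. lra. }
  assert (Hv : (Cmod (twist z l) < 1)%R) by now rewrite Cmod_twist.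
  assert (He : (Cmod (twist z m) < 1)%R) by now rewrite Cmod_twist.
  assert (Hzm : (Cmod (- z) < 1)%R) by now rewrite Cmod_opp.
  assert (HT : forall x, (Cmod x < 1)%R -> (Cmod (T (- z) x) <= 1)%R)
    by (intros x Hx; apply Cmod_T_le1; lra).
  assert (B1 : forall x, (Cmod x < 1)%R -> (Cmod (T (- z) x * sigma) <= 1)%R)
    by (intros x Hx; apply Cmod_mul_le1; auto).
  assert (B2 : forall x, (Cmod x < 1)%R ->
      (Cmod (T (- z) x * T (twist z m) (T (- z) x * sigma)) <= 1)%R)
    by (intros x Hx; apply Cmod_mul_le1; auto; apply Cmod_T_le1; auto).
  assert (B3 : forall x, (Cmod x < 1)%R ->
      (Cmod (T (- z) x * T (twist z l) (T (- z) x * T (twist z m) (T (- z) x * sigma))) <= 1)%R)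
    by (intros x Hx; apply Cmod_mul_le1; auto; apply Cmod_T_le1; auto).
  assert (RT : rational_on_disk (T (- z))).
  { apply (rational_T (f := fun x => x)); [exact Hzm | intros; lra | apply rational_id]. }
  split; [split; [|split]|].
  - apply rational_analytic. unfold nested.
    apply rational_mul; [apply rational_id|].
    apply rational_T; [exact Hu | exact B3|]. apply rational_mul; [exact RT|].
    apply rational_T; [exact Hv | exact B2|]. apply rational_mul; [exact RT|].
    apply rational_T; [exact He | exact B1|]. apply rational_mul; [exact RT|].
    apply rational_const.
  - intros x Hx. rewrite unit_disk_iff in *. unfold nested. rewrite Cmod_mult.
    pose proof (Cmod_T_le1 Hu (B3 x Hx)) as H. pose proof (Cmod_ge_0 x).
    match goal with |- (_ * ?b < 1)%R => pose proof (Cmod_ge_0 x); assert (0 <= b)%R by apply Cmod_ge_0 end.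
    nra.
  - unfold nested. ring.
  - unfold nested. rewrite T_self, Cmult_0_l. unfold T.
    replace (1 + Cconj (w / z) * 0) with (RtoC 1) by ring. field. exact Hz0.
Qed.

Lemma nested_derivatives (z w l m sigma : C) :
  (Cmod z < 1)%R -> (Cmod w < Cmod z)%R -> (Cmod l < 1)%R -> (Cmod m < 1)%R ->
  (Cmod sigma <= 1)%R ->
  C_derive_n (nested z w l m sigma) 1 z = first_datum z w l /\
  C_derive_n (nested z w l m sigma) 2 z = second_datum z w l m /\
  C_derive_n (nested z w l m sigma) 3 z
    = third_center z w l m + third_slope z w l m * sigma.
Proof.
  intros Hz Hwz Hl Hm Hs.
  apply (@derivatives_of_third_parameter _ (fun _ => sigma)).
  - now apply nested_H0.
  - exact Hz.
  - apply Cmod_gt_0. pose proof (Cmod_ge_0 w). lra.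
  - intros x _. split; [apply smooth_const | exact Hs].
  - reflexivity.
Qed.

(** * Disks and circles *)

(** At a point of the circle, a small move towards the centre enters the disk. *)
Lemma boundary_open_disk (c z : C) (rho : R) :
  (0 < rho)%R -> boundary (open_disk c rho) z <-> Cmod (z - c) = rho.
Proof.
  intros Hr. split.
  - intros [Hin Hout].
    destruct (Rtotal_order (Cmod (z - c)) rho) as [H|[H|H]]; [exfalso|exact H|exfalso].
    + apply Hin. apply (locally_le_locally_norm (K := C_AbsRing) (V := C_NormedModule)).
      exists (mkposreal (rho - Cmod (z - c)) ltac:(lra)).
      cut (forall x : C, (Cmod (x - z) < rho - Cmod (z - c))%R -> open_disk c rho x).
      { intros Hg x Hx. exact (Hg x Hx). }
      intros x Hx. unfold open_disk.
      replace (x - c) with ((x - z) + (z - c)) by ring.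
      eapply Rle_lt_trans; [apply Cmod_triangle | lra].
    + apply Hout. apply (locally_le_locally_norm (K := C_AbsRing) (V := C_NormedModule)).
      exists (mkposreal (Cmod (z - c) - rho) ltac:(lra)).
      cut (forall x : C, (Cmod (x - z) < Cmod (z - c) - rho)%R -> ~ open_disk c rho x).
      { intros Hg x Hx. exact (Hg x Hx). }
      intros x Hx. unfold open_disk. intros Hc.
      pose proof (Cmod_triangle (x - c) (- (x - z))) as Ht. rewrite Cmod_opp in Ht.
      replace (x - c + - (x - z)) with (z - c) in Ht by ring. lra.
  - intros H. split.
    + intros Hin. apply (locally_singleton (T := C_UniformSpace)) in Hin.
      unfold open_disk in Hin. lra.
    + intros [eps Hout].
      set (t := Rmin (/ 2) (eps / (2 * rho))).
      pose proof (cond_pos eps) as He.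
      assert (Ht0 : (0 < t)%R)
        by (apply Rmin_glb_lt; [lra | apply Rdiv_lt_0_compat; lra]).
      assert (Ht1 : (t <= / 2)%R) by apply Rmin_l.
      assert (Ht2 : (t * rho <= eps / 2)%R).
      { apply Rle_trans with (eps / (2 * rho) * rho)%R.
        - apply Rmult_le_compat_r; [lra | apply Rmin_r].
        - right. field. lra. }
      apply (Hout (z - t * (z - c))).
      * apply C_NormedModule_mixin_compat1.
        change (Cmod (z - t * (z - c) - z) < eps)%R.
        replace (z - t * (z - c) - z) with (- (t * (z - c))) by ring.
        rewrite Cmod_opp, Cmod_mult, Cmod_R, H, Rabs_pos_eq by lra. lra.
      * unfold open_disk. replace (z - t * (z - c) - c) with (RtoC (1 - t) * (z - c)).
        2:{ rewrite RtoC_minus. ring. }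
        rewrite Cmod_mult, Cmod_R, H, Rabs_pos_eq by lra. nra.
Qed.

Lemma Cmod_expi (theta : R) : Cmod (expi theta) = 1%R.
Proof.
  unfold Cmod, expi. simpl fst; simpl snd.
  replace (cos theta ^ 2 + sin theta ^ 2)%R with 1%R; [apply sqrt_1|].
  pose proof (sin2_cos2 theta) as H. unfold Rsqr in H. simpl. lra.
Qed.

Lemma unimodular_expi (x : C) : Cmod x = 1%R -> exists theta : R, x = expi theta.
Proof.
  intros H. destruct x as [a b].
  assert (E : (a ^ 2 + b ^ 2 = 1)%R).
  { pose proof (Cmod2_alt (a, b)) as E. rewrite H in E. unfold Re, Im in E. simpl in *. lra. }
  assert (Ha : (-1 <= a <= 1)%R) by (simpl in E; nra).
  assert (Es : (1 - a ^ 2 = b ^ 2)%R) by lra.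
  destruct (Rle_lt_dec 0 b) as [Hb|Hb].
  - exists (acos a). unfold expi. rewrite cos_acos, sin_acos by exact Ha.
    f_equal. unfold Rsqr. replace (1 - a * a)%R with (b ^ 2)%R by (rewrite <- Es; ring).
    symmetry. now apply sqrt_pow2.
  - exists (- acos a)%R. unfold expi. rewrite cos_neg, sin_neg, cos_acos, sin_acos by exact Ha.
    f_equal. unfold Rsqr. replace (1 - a * a)%R with ((- b) ^ 2)%R by (simpl in *; lra).
    rewrite sqrt_pow2 by lra. ring.
Qed.

(** * The region of values of the third derivative *)

Theorem theorem1p1 (z0 w0 lambda mu : C)
  (hz0 : unit_disk z0) (hw0 : unit_disk w0) (hsr : (Cmod w0 < Cmod z0)%R)
  (hlambda : closed_unit_disk lambda) (hmu : closed_unit_disk mu) :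
  let r := Cmod z0 in
  let s := Cmod w0 in
  let w1 := w0 / z0 + (r ^ 2 - s ^ 2) / (z0 * (1 - r ^ 2)) * lambda in
  let w2 :=
    2 * (r ^ 2 - s ^ 2) * lambda * (1 - Cconj w0 * lambda)
      / (z0 ^ 2 * (1 - r ^ 2) ^ 2)
    + 2 * (r ^ 2 - s ^ 2) * (1 - Cmod lambda ^ 2)
      / (z0 * (1 - r ^ 2) ^ 2) * mu in
  let B :=
    Cconj w0 ^ 2 * lambda ^ 3 - Cconj w0 * (1 + r ^ 2) * lambda ^ 2
    + r ^ 2 * lambda in
  let c :=
    6 * (r ^ 2 - s ^ 2) / (z0 ^ 3 * (1 - r ^ 2) ^ 3)
    * (B + z0 * mu * (1 - Cmod lambda ^ 2)
           * (1 + r ^ 2 - 2 * Cconj w0 * lambda - z0 * Cconj lambda * mu)) in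
  let rho :=
    (6 * (r ^ 2 - s ^ 2) / (r * (1 - r ^ 2) ^ 3)
     * (1 - Cmod lambda ^ 2) * (1 - Cmod mu ^ 2))%R in
  let u0 := w0 / z0 in
  let v0 := r ^ 2 * lambda / z0 ^ 2 in
  let tau := Cconj z0 * mu / z0 in
  (* eta is the value forced by f''(z0) = w2 on the innermost function in (3);
     the further summand
       lambda^2 r^2 (r^2 w0 - z0^2 (Cconj w0)) / (z0^5 (1 - |lambda|^2))
     in the source is nonzero in general and contradicts f''(z0) = w2 then *)
  let eta := r ^ 2 * mu / z0 ^ 2 in
  (Cmod lambda = 1%R ->
     forall f : C -> C, has_data z0 w0 w1 w2 f ->
       C_derive_n f 3 z0 = c /\
       (forall z : C, unit_disk z -> f z = z * T u0 (v0 * T (- z0) z))) /\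
  ((Cmod lambda < 1)%R -> Cmod mu = 1%R ->
     forall f : C -> C, has_data z0 w0 w1 w2 f ->
       C_derive_n f 3 z0 = c /\
       (forall z : C, unit_disk z ->
          f z = z * T u0 (T (- z0) z * T v0 (tau * T (- z0) z)))) /\
  ((Cmod lambda < 1)%R -> (Cmod mu < 1)%R ->
     (forall w3 : C, region_of_values z0 w0 w1 w2 w3 <-> closed_disk c rho w3) /\
     (forall f : C -> C, has_data z0 w0 w1 w2 f ->
        (boundary (open_disk c rho) (C_derive_n f 3 z0) <->
         exists theta : R, forall z : C, unit_disk z ->
           f z = z * T u0 (T (- z0) z
                           * T v0 (T (- z0) z
                                   * T eta (expi theta * T (- z0) z)))))).
Proof.
  intros r s w1 w2 B c rho u0 v0 tau eta.
  pose proof (proj1 (unit_disk_iff z0) hz0) as Hz. clear hz0 hw0.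
  pose proof (Cmod_ge_0 w0) as Hw. pose proof (Cmod_ge_0 lambda) as Hl0.
  pose proof (Cmod_ge_0 mu) as Hm0.
  assert (Hz0 : z0 <> 0) by (apply Cmod_gt_0; lra).
  pose proof (one_sub_conj_ne0 Hz) as Hd. pose proof (Cconj_ne0 Hz0) as Hc0.
  assert (Emod : forall a : C, RtoC (Cmod a) ^ 2 = a * Cconj a).
  { intros a. now rewrite <- RtoC_pow, conj_mul_self. }
  assert (Er : RtoC r ^ 2 = z0 * Cconj z0) by apply Emod.
  assert (Es : RtoC s ^ 2 = w0 * Cconj w0) by apply Emod.
  assert (Ew1 : w1 = first_datum z0 w0 lambda).
  { unfold w1. rewrite Er, Es. reflexivity. }
  assert (Ew2 : w2 = second_datum z0 w0 lambda mu).
  { unfold w2. rewrite Er, Es, Emod. reflexivity. }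
  assert (Ec : c = third_center z0 w0 lambda mu).
  { unfold c, B. rewrite Er, Es, Emod. reflexivity. }
  assert (Ev0 : v0 = twist z0 lambda).
  { unfold v0. rewrite Er. unfold twist. field. exact Hz0. }
  assert (Eeta : eta = twist z0 mu).
  { unfold eta. rewrite Er. unfold twist. field. exact Hz0. }
  rewrite Ew1, Ew2, Ec, Ev0, Eeta. change tau with (twist z0 mu). unfold u0.
  clear w1 w2 B c v0 eta tau u0 Ew1 Ew2 Ec Ev0 Eeta.
  split; [|split].
  - intros Hl f [Hf [Hf0 [Hf1 Hf2]]].
    destruct (first_parameter Hf Hz hsr Hf0 Hf1) as [y [Hy [Hyz E]]].
    assert (Hconst : forall x, (Cmod x < 1)%R -> y x = twist z0 lambda).
    { intros x Hx. rewrite <- Hyz. apply schur_unimodular_const; try assumption.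
      now rewrite Hyz, Cmod_twist. }
    assert (E' : forall x, (Cmod x < 1)%R ->
              f x = x * T (w0 / z0) (T (- z0) x * twist z0 lambda)).
    { intros x Hx. now rewrite (E x Hx), (Hconst x Hx). }
    assert (Hdl : defect lambda = 0).
    { unfold defect. rewrite conj_mul_self, Hl, <- RtoC_minus. f_equal. ring. }
    split.
    + destruct (@derivatives_of_parameters f (fun _ => twist z0 lambda) z0 w0 lambda mu 0 0
                  (proj1 Hf) Hz Hz0 E') as [_ [_ ->]].
      (* the constant [y] has the required coefficients because [defect lambda = 0] *)
      * eapply expands_coefs; [| | | |apply expands_const]; rewrite ?Hdl; unfold Cdiv; ring.
      * ring.
    + intros x Hx. rewrite unit_disk_iff in Hx. rewrite (E' x Hx).
      now rewrite (Cmult_comm (T (- z0) x)).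
  - intros Hl Hm f [Hf [Hf0 [Hf1 Hf2]]].
    destruct (second_parameter Hf Hz hsr Hl Hf0 Hf1 Hf2) as [q [Hq [Hqz E]]].
    assert (Hconst : forall x, (Cmod x < 1)%R -> q x = twist z0 mu).
    { intros x Hx. rewrite <- Hqz. apply schur_unimodular_const; try assumption.
      now rewrite Hqz, Cmod_twist. }
    assert (E' : forall x, (Cmod x < 1)%R ->
              f x = x * T (w0 / z0) (T (- z0) x * T (twist z0 lambda) (T (- z0) x * twist z0 mu))).
    { intros x Hx. now rewrite (E x Hx), (Hconst x Hx). }
    split.
    + destruct (@derivatives_of_second_parameter f (fun _ => twist z0 mu) z0 w0 lambda mu 0 0 0
                  (proj1 Hf) Hz Hz0 E') as [_ [_ ->]].
      * eapply expands_coefs; [| | | |apply expands_const]; unfold Cdiv; ring.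
      * ring.
    + intros x Hx. rewrite unit_disk_iff in Hx. rewrite (E' x Hx).
      now rewrite (Cmult_comm (twist z0 mu)).
  - intros Hl Hm.
    assert (Hr0 : (0 < r)%R) by (apply Cmod_gt_0; exact Hz0).
    assert (Hrho : (0 < rho)%R).
    { unfold rho. repeat apply Rmult_lt_0_compat; try apply Rinv_0_lt_compat;
        try apply Rmult_lt_0_compat; try apply pow_lt; unfold r, s in *; simpl; nra. }
    assert (Eslope : third_slope z0 w0 lambda mu = RtoC (rho * r) / Cconj z0).
    { unfold third_slope, sqr_gap, defect. rewrite <- Er, <- Es, <- !Emod.
      assert (H1 : RtoC r <> 0) by (intros Hc; apply RtoC_inj in Hc; lra).
      assert (H2 : 1 - RtoC r ^ 2 <> 0) by (rewrite Er; exact Hd).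
      assert (H3 : (0 < r * (1 - r ^ 2) ^ 3)%R).
      { apply Rmult_lt_0_compat; [exact Hr0|]. apply pow_lt. unfold r in *. simpl. nra. }
      unfold rho.
      rewrite !RtoC_mult, RtoC_div by lra.
      rewrite !RtoC_mult, !RtoC_minus, !RtoC_pow, !RtoC_minus, !RtoC_pow.
      field. repeat split; assumption. }
    assert (Hslope : Cmod (third_slope z0 w0 lambda mu) = rho).
    { rewrite Eslope, Cmod_div, Cmod_conj, Cmod_R by exact Hc0. fold r.
      rewrite Rabs_pos_eq by (apply Rmult_le_pos; lra). field. lra. }
    assert (Hslope0 : third_slope z0 w0 lambda mu <> 0) by (apply Cmod_gt_0; lra).
    assert (Hdist : forall x, Cmod (third_center z0 w0 lambda mu
        + third_slope z0 w0 lambda mu * x - third_center z0 w0 lambda mu) = (rho * Cmod x)%R).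
    { intros x. rewrite <- Hslope, <- Cmod_mult. f_equal. ring. }
    split.
    + intros w3. split.
      * intros [f [[Hf [Hf0 [Hf1 Hf2]]] <-]].
        destruct (third_parameter Hf Hz hsr Hl Hm Hf0 Hf1 Hf2) as [k [Hk E]].
        destruct (derivatives_of_third_parameter (proj1 Hf) Hz Hz0 Hk E) as [_ [_ ->]].
        unfold closed_disk. rewrite Hdist. pose proof (proj2 (Hk z0 Hz)). nra.
      * intros Hw3. unfold closed_disk in Hw3.
        set (sigma := (w3 - third_center z0 w0 lambda mu) / third_slope z0 w0 lambda mu).
        assert (Hsig : (Cmod sigma <= 1)%R).
        { unfold sigma. rewrite Cmod_div, Hslope by exact Hslope0.
          apply Rmult_le_reg_r with rho; [exact Hrho|].
          unfold Rdiv. rewrite Rmult_assoc, Rinv_l by lra. lra. }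
        destruct (nested_H0 Hz hsr Hl Hm Hsig) as [N1 N2].
        destruct (nested_derivatives Hz hsr Hl Hm Hsig) as [D1 [D2 D3]].
        exists (nested z0 w0 lambda mu sigma).
        split; [now repeat split; try apply N1|].
        rewrite D3. unfold sigma. field. exact Hslope0.
    + intros f [Hf [Hf0 [Hf1 Hf2]]]. rewrite (boundary_open_disk _ _ Hrho).
      destruct (third_parameter Hf Hz hsr Hl Hm Hf0 Hf1 Hf2) as [k [Hk E]].
      split.
      * destruct (derivatives_of_third_parameter (proj1 Hf) Hz Hz0 Hk E) as [_ [_ ->]].
        rewrite Hdist. intros Hbd.
        assert (Hkz : Cmod (k z0) = 1%R) by (apply Rmult_eq_reg_l with rho; lra).
        destruct (unimodular_expi Hkz) as [theta Ht]. exists theta.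
        intros x Hx. rewrite unit_disk_iff in Hx.
        rewrite (E x Hx), (schur_unimodular_const Hk Hz Hkz Hx), Ht.
        now rewrite (Cmult_comm (expi theta)).
      * intros [theta Ht].
        destruct (@derivatives_of_third_parameter f (fun _ => expi theta) z0 w0 lambda mu
                    (proj1 Hf) Hz Hz0) as [_ [_ ->]].
        -- intros x _. split; [apply smooth_const | rewrite Cmod_expi; lra].
        -- intros x Hx. rewrite (Ht x (proj2 (unit_disk_iff x) Hx)).
           now rewrite (Cmult_comm (expi theta)).
        -- rewrite Hdist, Cmod_expi. ring.
Qed.
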